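(* Let $\chi:(0,\infty)\to\mathbb C$ be a measurable function with $\chi(t)=1$ for $0<t\le1$ and $|\chi(t)|\le1$ for all $t\ge1$, and let $\sigma$ be the corresponding solution of the integral equation given in the context. Suppose that $\sigma_\infty\ne0$ is a complex number such that, for some $A>0$, $|\sigma(u)-\sigma_\infty|\le\exp(-(u/A)\log u)$ for all sufficiently large $u$. Then either $\chi(t)=1$ for almost every $t\ge A$, or the integral $$\int_0^\infty\frac{|1-\chi(t)|}{t}\,e^{Ct}\,dt$$ diverges for some $C\ge0$.
   Context: Given $\chi$ as in the claim, $\sigma:[0,\infty)\to\mathbb C$ is the unique (continuous) function with $\sigma(u)=1$ for $0\le u\le1$ and $$u\,\sigma(u)=\int_0^u\chi(t)\,\sigma(u-t)\,dt\qquad(u>1).$$ *)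

(* Defs.v *)
From HB Require Import structures.
From mathcomp Require Import all_boot all_order all_algebra complex.
From mathcomp Require Import all_classical all_reals all_analysis.

Set Implicit Arguments.
Unset Strict Implicit.
Unset Printing Implicit Defensive.

Import Order.TTheory GRing.Theory Num.Theory numFieldNormedType.Exports.

Local Open Scope classical_set_scope.
Local Open Scope ring_scope.
Local Open Scope complex_scope.

(* "Measurable" means Lebesgue measurable, not just Borel: [lebesgueType R] is
   [R] with the sigma-algebra on which [completed_lebesgue_measure] is defined;
   the canonical measurable structure on [R] itself is the Borel one. *)
Notation lebesgueType R :=
  (caratheodory_type (wlength (@idfun R))^*%mu).

(* The library has no measurable structure on [R[i]]; measurability and the
   integral are taken on real and imaginary parts. *)
Definition cmeasurable_fun (R : realType) (D : set R) (f : R -> R[i]) : Prop :=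
  measurable_fun (D : set (lebesgueType R))
    ((fun t => complex.Re (f t)) : lebesgueType R -> R) /\
  measurable_fun (D : set (lebesgueType R))
    ((fun t => complex.Im (f t)) : lebesgueType R -> R).

Definition cintegral (R : realType) (D : set R) (f : R -> R[i]) : R[i] :=
  (\int[@completed_lebesgue_measure R]_(t in D) complex.Re (f t)) +i*
  (\int[@completed_lebesgue_measure R]_(t in D) complex.Im (f t)).

(* [chi] and [sigma] are total functions, but only the values of [chi] on
   (0, oo) and of [sigma] on [0, oo) matter. [R[i]^o] carries the topology of
   the complex modulus. *)
Definition integral_equation_solution (R : realType)
    (chi sigma : R -> R[i]) : Prop :=
  [/\ {within `[0, +oo[, continuous (sigma : R -> R[i]^o)},
      forall u : R, 0 <= u <= 1 -> sigma u = 1 &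
      forall u : R, 1 < u ->
        u%:C * sigma u = cintegral `]0, u[ (fun t => chi t * sigma (u - t))].

(* Main.v *)
Require Import Defs.
From HB Require Import structures.
From mathcomp Require Import all_boot all_order all_algebra complex.
From mathcomp Require Import all_classical all_reals all_analysis.
From mathcomp Require Import measurable_realfun ring lra.

(** Write [phi = 1 - chi], [psi = phi / t], [tau = sigma - sigma_oo], and [L] for
    the Laplace transform. It suffices to show that if
    [int |psi(t)| exp(C t) dt] is finite for every [C >= 0], then [chi = 1]
    almost everywhere beyond [A].

    In that case [L psi] and [L phi] are entire, and so is [L tau] because [tau]
    decays faster than any exponential. The integral equation reads
    [u tau(u) = sigma_oo T_phi(u) - T_tau(u) - (phi * tau)(u)], where [T_f(u)] is
    the integral of [f] over [(u, oo)] ([renewal_identity]). Transforming it and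
    using [s L(T_f)(s) = L f(0) - L f(s)] gives for [J(s) = sigma_oo + s L tau(s)]
    the differential equation [J' = L phi * J], while [(L psi)' = - L phi]; so
    [|J(s)| = |sigma_oo| exp(Re (L psi(0)) - Re (L psi(s)))] ([laplace_exp]).

    The bound [|tau(u)| <= exp(- (u / A) ln u)] makes [|J(s)|] at most doubly
    exponential: [ln |J(s)| <= K exp(A |s|)]. As [sigma_oo] is nonzero, this
    bounds [Re (L psi(s))] from below by [- K exp(A |s|)]
    ([laplace_lower_bound]). A one-sided bound for the real part of an entire
    function on circles bounds its Taylor coefficients (Borel and
    Caratheodory). The coefficients of [L psi(- z)] are the moments
    [int psi(t) t^k / k! dt], and averaging over a circle of radius [r] with the
    nonnegative weight [1 - cos(k th)] gives
    [r^k int Re psi(t) t^k / k! dt <= K' exp(A r)] for all [k] and [r]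
    ([moment_bound]).

    Finally [|chi| <= 1] makes [Re psi] nonnegative, so the same bound holds for
    the part of the moments coming from [t >= T]. Summed over [k] it yields
    [exp(la T r) int_(t >= T) Re psi <= D exp(A r)] for any [la < 1], with [D]
    independent of [r]. If [T > A], choose [la T > A] and let [r] tend to
    infinity: [Re psi] vanishes almost everywhere on [t >= T]
    ([tail_integral_eq0]). Thus [Re chi = 1], and with [|chi| <= 1] also
    [chi = 1], almost everywhere beyond [A].

    Complex analysis is reduced to real calculus: the differential equation is
    followed along rays and for the modulus only, and averages over circles are
    averages over roots of unity, with the explicit Taylor remainder
    [expcos_taylor] in place of Cauchy's formula. *)

Set Implicit Arguments.
Unset Strict Implicit.
Unset Printing Implicit Defensive.

Import Order.TTheory GRing.Theory Num.Theory numFieldNormedType.Exports.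

Local Open Scope classical_set_scope.
Local Open Scope ring_scope.
Local Open Scope complex_scope.

Local Notation Re := (@complex.Re _).
Local Notation Im := (@complex.Im _).
Local Notation normc := (@Normc.normc _).

(** * The complex exponential through real and imaginary parts *)

(** Locked, because otherwise conversion tests on complex expressions unfold it
    down to pairs of power series. *)
HB.lock Definition cexp {R : realType} (z : R[i]) : R[i] :=
  (expR (Re z))%:C * (cos (Im z) +i* sin (Im z)).

Section complex_basics.
Context {R : realType}.
Implicit Types z w : R[i].

Lemma ReD z w : Re (z + w) = Re z + Re w.
Proof. by case: z w => ? ? []. Qed.

Lemma ImD z w : Im (z + w) = Im z + Im w.
Proof. by case: z w => ? ? []. Qed.

Lemma ReN z : Re (- z) = - Re z.
Proof. by case: z. Qed.

Lemma ImN z : Im (- z) = - Im z.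
Proof. by case: z. Qed.

Lemma ReM z w : Re (z * w) = Re z * Re w - Im z * Im w.
Proof. by case: z w => ? ? []. Qed.

Lemma ImM z w : Im (z * w) = Re z * Im w + Im z * Re w.
Proof. by case: z w => ? ? []. Qed.

Lemma complex_ext z w : Re z = Re w -> Im z = Im w -> z = w.
Proof. by case: z w => a b [c d] /= -> ->. Qed.

Lemma normc_ge0 z : 0 <= normc z.
Proof. by case: z => a b; exact: sqrtr_ge0. Qed.

Lemma sqr_normcE z : normc z ^+ 2 = Re z ^+ 2 + Im z ^+ 2.
Proof. by case: z => a b /=; rewrite sqr_sqrtr// addr_ge0// sqr_ge0. Qed.

Lemma Re_le_normc z : `|Re z| <= normc z.
Proof.
rewrite -(@ler_pXn2r _ 2) ?nnegrE ?normc_ge0//.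
by rewrite sqr_normcE real_normK ?num_real// lerDl sqr_ge0.
Qed.

Lemma Im_le_normc z : `|Im z| <= normc z.
Proof.
rewrite -(@ler_pXn2r _ 2) ?nnegrE ?normc_ge0//.
by rewrite sqr_normcE real_normK ?num_real// lerDr sqr_ge0.
Qed.

Lemma normc_le_ReIm z : normc z <= `|Re z| + `|Im z|.
Proof.
rewrite -(@ler_pXn2r _ 2) ?nnegrE ?normc_ge0 ?addr_ge0//.
rewrite sqr_normcE sqrrD !real_normK ?num_real//.
by rewrite [leRHS]addrAC lerDl mulrn_wge0// mulr_ge0.
Qed.

Lemma cnormN z : normc (- z) = normc z.
Proof. exact: (@normcN R z). Qed.

Lemma cnormD z w : normc (z + w) <= normc z + normc w.
Proof. exact: (@le_normcD R z w). Qed.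

Lemma normc_real (x : R) : normc x%:C = `|x|.
Proof. by rewrite /normc /= expr0n addr0 sqrtr_sqr. Qed.

Lemma Re_cexp z : Re (cexp z) = expR (Re z) * cos (Im z).
Proof. by rewrite cexp.unlock ReM /= mul0r subr0. Qed.

Lemma Im_cexp z : Im (cexp z) = expR (Re z) * sin (Im z).
Proof. by rewrite cexp.unlock ImM /= mul0r addr0. Qed.

Lemma normc_cexp z : normc (cexp z) = expR (Re z).
Proof.
apply/eqP; rewrite -(@eqrXn2 _ 2) ?normc_ge0 ?expR_ge0//; apply/eqP.
by rewrite sqr_normcE Re_cexp Im_cexp !exprMn -mulrDr cos2Dsin2 mulr1.
Qed.

Lemma cexp0 : cexp (0 : R[i]) = 1.
Proof. by rewrite cexp.unlock /= expR0 cos0 sin0 mul1r. Qed.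

Lemma cexpD z w : cexp (z + w) = cexp z * cexp w.
Proof.
apply: complex_ext; rewrite ?ReM ?ImM !Re_cexp !Im_cexp ReD ImD expRD.
  by rewrite cosD; ring.
by rewrite sinD; ring.
Qed.

End complex_basics.

(** * Integrals of complex-valued functions *)

Section complex_integral.
Context d (Y : measurableType d) (R : realType) (m : {measure set Y -> \bar R}).
Implicit Types f g : Y -> R[i].

Definition cmfun f : Prop :=
  measurable_fun setT (Re \o f) /\ measurable_fun setT (Im \o f).

Definition cintegrable f : Prop :=
  m.-integrable setT (EFin \o (Re \o f)) /\
  m.-integrable setT (EFin \o (Im \o f)).

Definition cint f : R[i] :=
  (\int[m]_x Re (f x)) +i* (\int[m]_x Im (f x)).

Lemma eq_cint f g : f =1 g -> cint f = cint g.
Proof. by move=> /funext ->. Qed.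

Lemma cmfun_normc f : cmfun f -> measurable_fun setT (normc \o f).
Proof.
move=> [mr mi].
have -> : normc \o f = Num.sqrt \o (fun x => Re (f x) ^+ 2 + Im (f x) ^+ 2).
  by apply/funext => x /=; case: (f x).
apply: measurableT_comp.
  by apply: continuous_measurable_fun; exact: sqrt_continuous.
by apply: measurable_funD; exact: measurable_funX.
Qed.

Lemma cmfunM f g : cmfun f -> cmfun g -> cmfun (fun x => f x * g x).
Proof.
move=> [fr fi] [gr gi]; split.
  rewrite (_ : _ \o _ = ((Re \o f) \* (Re \o g)) \- ((Im \o f) \* (Im \o g))).
    by apply: measurable_funB; exact: measurable_funM.
  by apply/funext => x /=; rewrite ReM.
rewrite (_ : _ \o _ = ((Re \o f) \* (Im \o g)) \+ ((Im \o f) \* (Re \o g))).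
  by apply: measurable_funD; exact: measurable_funM.
by apply/funext => x /=; rewrite ImM.
Qed.

Lemma cmfun_cst (z : R[i]) : cmfun (fun=> z).
Proof. by split; exact: measurable_cst. Qed.

Lemma cmfun_real (f : Y -> R) :
  measurable_fun setT f -> cmfun (fun x => (f x)%:C).
Proof. by move=> mf; split => //; exact: measurable_cst. Qed.

Lemma cintegrable_mfun f : cintegrable f -> cmfun f.
Proof.
by move=> [/measurable_int/measurable_EFinP ? /measurable_int/measurable_EFinP].
Qed.

(** Domination of the modulus by a real integrable function is how
    integrability is established throughout. *)
Lemma le_cintegrable f (h : Y -> R) : cmfun f ->
  m.-integrable setT (EFin \o h) -> (forall x, normc (f x) <= h x) ->
  cintegrable f.
Proof.
move=> [mr mi] ih fh; split; apply: (le_integrable _ _ _ ih) => //.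
- exact/measurable_EFinP.
- move=> x _; rewrite /= lee_fin.
  by rewrite (le_trans (Re_le_normc _))// (le_trans (fh x))// ler_norm.
- exact/measurable_EFinP.
- move=> x _; rewrite /= lee_fin.
  by rewrite (le_trans (Im_le_normc _))// (le_trans (fh x))// ler_norm.
Qed.

Lemma cintegrable_normc f :
  cintegrable f -> m.-integrable setT (EFin \o (normc \o f)).
Proof.
move=> if_; have [fr fi] := if_.
have := integrableD measurableT (integrable_norm fr) (integrable_norm fi).
apply: le_integrable => //.
  by apply/measurable_EFinP/cmfun_normc/cintegrable_mfun.
move=> x _ /=; rewrite lee_fin ger0_norm ?normc_ge0//.
by rewrite (le_trans (normc_le_ReIm _))// ler_norm.
Qed.

Lemma cintegrableD f g :
  cintegrable f -> cintegrable g -> cintegrable (fun x => f x + g x).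
Proof.
move=> [fr fi] [gr gi]; split.
  rewrite (_ : _ \o _ = (EFin \o (Re \o f)) \+ (EFin \o (Re \o g)))%E.
    exact: integrableD.
  by apply/funext => x /=; rewrite ReD.
rewrite (_ : _ \o _ = (EFin \o (Im \o f)) \+ (EFin \o (Im \o g)))%E.
  exact: integrableD.
by apply/funext => x /=; rewrite ImD.
Qed.

Lemma cintD f g : cintegrable f -> cintegrable g ->
  cint (fun x => f x + g x) = cint f + cint g.
Proof.
move=> [fr fi] [gr gi]; rewrite /cint; apply: complex_ext => /=.
  under eq_Rintegral do rewrite ReD.
  by rewrite RintegralD.
under eq_Rintegral do rewrite ImD.
by rewrite RintegralD.
Qed.

Lemma cintegrableZ (z : R[i]) f : cintegrable f -> cintegrable (fun x => z * f x).
Proof.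
move=> if_; apply: (@le_cintegrable _ (fun x => normc z * normc (f x))).
- by apply: cmfunM; [exact: cmfun_cst|exact: cintegrable_mfun].
- exact: integrableZl (cintegrable_normc if_).
- by move=> x; rewrite Normc.normcM.
Qed.

Lemma cintZ (z : R[i]) f : cintegrable f -> cint (fun x => z * f x) = z * cint f.
Proof.
move=> [fr fi]; have iZ (k : R) (h : Y -> R) : m.-integrable setT (EFin \o h) ->
    m.-integrable setT (EFin \o (fun x => k * h x)).
  exact: integrableZl.
apply: complex_ext; rewrite ?ReM ?ImM /=.
  under eq_Rintegral do rewrite ReM.
  rewrite RintegralB//; last 2 first.
  - exact: iZ.
  - exact: iZ.
  by rewrite !RintegralZl.
under eq_Rintegral do rewrite ImM.
rewrite RintegralD//; last 2 first.
- exact: iZ.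
- exact: iZ.
by rewrite !RintegralZl.
Qed.

Lemma cintegrableN f : cintegrable f -> cintegrable (fun x => - f x).
Proof.
move=> /(cintegrableZ (-1)).
by rewrite (_ : (fun _ => -1 * _) = (fun x => - f x))//; apply/funext => x; rewrite mulN1r.
Qed.

Lemma cintN f : cintegrable f -> cint (fun x => - f x) = - cint f.
Proof.
by move=> /(cintZ (-1)); rewrite mulN1r => <-; apply: eq_cint => x; rewrite mulN1r.
Qed.

Lemma cint0 : cint (fun=> 0) = 0.
Proof. by apply: complex_ext; rewrite /= Rintegral_cst// mul0r. Qed.

(** The factor [2] comes from estimating the real and imaginary parts
    separately; every use tolerates a constant factor. *)
Lemma normc_cint_le f (h : Y -> R) : cmfun f ->
  m.-integrable setT (EFin \o h) -> (forall x, normc (f x) <= h x) ->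
  normc (cint f) <= 2 * \int[m]_x h x.
Proof.
move=> mf ih fh; have [fr fi] := le_cintegrable mf ih fh.
rewrite (le_trans (normc_le_ReIm _))// mulr_natl mulr2n lerD//=.
  rewrite (le_trans (le_normr_Rintegral _ fr))//.
  apply: le_Rintegral => //; first exact: integrable_norm.
  by move=> x _; rewrite /= (le_trans (Re_le_normc _)).
rewrite (le_trans (le_normr_Rintegral _ fi))//.
apply: le_Rintegral => //; first exact: integrable_norm.
by move=> x _; rewrite /= (le_trans (Im_le_normc _)).
Qed.

End complex_integral.

(** * Fubini's theorem for complex-valued functions *)

Section complex_fubini.
Context d1 d2 (Y1 : measurableType d1) (Y2 : measurableType d2) (R : realType).
Variables (m1 : {sigma_finite_measure set Y1 -> \bar R})
          (m2 : {sigma_finite_measure set Y2 -> \bar R}).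

(** Real-valued integrals return [0] on non-integrable functions, so the
    sections are assumed integrable everywhere, not merely almost everywhere. *)
Lemma Rintegral_fubini (f : Y1 * Y2 -> R) :
  (m1 \x m2)%E.-integrable setT (EFin \o f) ->
  (forall x, m2.-integrable setT (fun y => (f (x, y))%:E)) ->
  (forall y, m1.-integrable setT (fun x => (f (x, y))%:E)) ->
  [/\ m1.-integrable setT (fun x => (\int[m2]_y f (x, y))%:E),
      m2.-integrable setT (fun y => (\int[m1]_x f (x, y))%:E) &
      \int[m1]_x \int[m2]_y f (x, y) = \int[m2]_y \int[m1]_x f (x, y)].
Proof.
move=> intf intf1 intf2.
have E1 : (fun x => (\int[m2]_y f (x, y))%:E) =
    fubini_F m2 (EFin \o f).
  by apply/funext => x; rewrite /Rintegral fineK// integrable_fin_num//; exact: intf1.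
have E2 : (fun y => (\int[m1]_x f (x, y))%:E) =
    fubini_G m1 (EFin \o f).
  by apply/funext => y; rewrite /Rintegral fineK// integrable_fin_num//; exact: intf2.
split.
- by rewrite E1; exact: integrable_fubini_F.
- have mf : measurable_fun setT (EFin \o f) by exact: measurable_int intf.
  rewrite E2 -[fubini_G _ _]/(fubini_F m1 (EFin \o f \o unstable.swap)).
  apply: integrable_fubini_F; apply/integrable12ltyP.
    by apply: measurableT_comp => //; exact: measurable_swap.
  by apply/(integrable21ltyP m1).
rewrite [LHS]/Rintegral [RHS]/Rintegral; congr fine.
rewrite [LHS](_ : _ = \int[m1]_x fubini_F m2 (EFin \o f) x)%E; last by rewrite E1.
rewrite [RHS](_ : _ = \int[m2]_x fubini_G m1 (EFin \o f) x)%E; last by rewrite E2.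
exact: Fubini.
Qed.

Lemma cint_fubini (F : Y1 * Y2 -> R[i]) (h : Y1 -> R) : cmfun F ->
  (forall x, cintegrable m2 (fun y => F (x, y))) ->
  m1.-integrable setT (EFin \o h) ->
  (forall x, \int[m2]_y normc (F (x, y)) <= h x) ->
  (forall y, cintegrable m1 (fun x => F (x, y))) ->
  [/\ cintegrable m1 (fun x => cint m2 (fun y => F (x, y))),
      cintegrable m2 (fun y => cint m1 (fun x => F (x, y))) &
      cint m1 (fun x => cint m2 (fun y => F (x, y))) =
      cint m2 (fun y => cint m1 (fun x => F (x, y)))].
Proof.
move=> mF F1 ih Fh F2.
have inF : (m1 \x m2)%E.-integrable setT (EFin \o (normc \o F)).
  apply/integrable12ltyP; first exact/measurable_EFinP/cmfun_normc.
  apply: (@le_lt_trans _ _ (\int[m1]_x (h x)%:E)%E); last first.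
    by have /(integrable_lty measurableT) := ih.
  have E x : (\int[m2]_y `|(EFin \o (normc \o F)) (x, y)| =
     (\int[m2]_y normc (F (x, y)))%:E)%E.
    rewrite /Rintegral fineK; last first.
      by rewrite integrable_fin_num//; exact: cintegrable_normc (F1 x).
    by apply: eq_integral => y _ /=; rewrite ger0_norm ?normc_ge0.
  apply: ge0_le_integral => //.
  - by move=> x _; exact: integral_ge0.
  - apply: (@measurable_fun_fubini_tonelli_F _ _ _ _ _ m2
      (abse \o (EFin \o (normc \o F)))) => [|z]; last exact: abse_ge0.
    by apply: measurableT_comp => //; exact/measurable_EFinP/cmfun_normc.
  - exact: (measurable_int m1 ih).
  - by move=> x _; rewrite E lee_fin.
have [iRe iIm] : cintegrable (m1 \x m2)%E F.
  by apply: (le_cintegrable mF inF) => z /=.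
have [a1 a2 a3] := Rintegral_fubini iRe (fun x => (F1 x).1) (fun x => (F2 x).1).
have [b1 b2 b3] := Rintegral_fubini iIm (fun x => (F1 x).2) (fun x => (F2 x).2).
by split; [split|split|rewrite /cint /=; congr (_ +i* _)].
Qed.

End complex_fubini.

(** * Coordinates distributed like Lebesgue measure *)

Section lebesgue_transport.
Context {R : realType}.
Local Notation mu := (@lebesgue_measure R).

(** Chi is measurable for the Lebesgue sigma-algebra while sigma is Borel. To
    treat both at once, integrals are taken over an arbitrary measure space
    with a real coordinate [p] whose image measure is Lebesgue measure: the
    completed Lebesgue line with the identity is one example, and functions of
    the coordinate inherit the translation and reflection invariance of the
    line. *)
Definition lebesgue_distributed d (Y : measurableType d)
    (m : {measure set Y -> \bar R}) (p : Y -> R) : Prop :=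
  measurable_fun setT p /\
  forall A : set R, measurable A -> mu A = m (p @^-1` A).

Lemma lebesgue_measure_bnd (b0 b1 : bool) (a b : R) : a <= b ->
  mu [set` Interval (BSide b0 a) (BSide b1 b)] = (b - a)%:E.
Proof.
rewrite lebesgue_measure_itv/= lte_fin.
by rewrite le_eqVlt => /predU1P[->|->]//; rewrite ltxx subrr.
Qed.

Section transport.
Context d (Y : measurableType d) (m : {measure set Y -> \bar R}).
Variables (p : Y -> measurableTypeR R) (hp : lebesgue_distributed m p).
Variables (f : R -> R) (mf : measurable_fun setT f).

Let mp : measurable_fun setT p. Proof. exact: hp.1. Qed.

Lemma integrable_transport :
  m.-integrable setT (EFin \o (f \o p)) <-> mu.-integrable setT (EFin \o f).
Proof.
have mEf : measurable_fun setT (EFin \o f) by exact/measurable_EFinP.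
have mEfp : measurable_fun setT (EFin \o (f \o p)).
  by apply: (measurableT_comp mEf); exact: mp.
have E : (\int[mu]_x `|(f x)%:E| = \int[m]_x `|(f (p x))%:E|)%E.
  rewrite (eq_measure_integral (pushforward m p)); last first.
    by move=> A mA _; exact: hp.2.
  by rewrite ge0_integral_pushforward//; apply: measurableT_comp.
by split=> /integrableP[_ h]; apply/integrableP; split => //; move: h; rewrite /= E.
Qed.

Lemma Rintegral_transport : m.-integrable setT (EFin \o (f \o p)) ->
  \int[m]_x f (p x) = \int[mu]_x f x.
Proof.
move=> ifp; rewrite /Rintegral; congr fine.
rewrite [RHS](eq_measure_integral (pushforward m p)); last first.
  by move=> A mA _; exact: hp.2.
by rewrite (integral_pushforward mp)//; exact/measurable_EFinP.
Qed.

End transport.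

Lemma lebesgue_measure_shift (t : R) (A : set R) : measurable A ->
  mu A = mu ((fun u => u - t) @^-1` A).
Proof.
pose sh : measurableTypeR R -> measurableTypeR R := fun u => u - t.
have msh : measurable_fun setT sh by exact: measurable_funB.
apply: (@lebesgue_measure_unique _ (pushforward mu sh)) => //.
move=> _ [[a b] _ <-] /=; rewrite /pushforward /sh.
rewrite (_ : _ @^-1` _ = `](a + t), (b + t)]%classic); last first.
  by apply/seteqP; split=> x /=; rewrite !in_itv/= ltrBrDr lerBlDr.
by rewrite !lebesgue_measure_itv/= !lte_fin ltrD2r; case: ifP => // _; congr EFin; ring.
Qed.

Lemma lebesgue_measure_reflect (t : R) (A : set R) : measurable A ->
  mu A = mu ((fun u => t - u) @^-1` A).
Proof.
pose sh : measurableTypeR R -> measurableTypeR R := fun u => t - u.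
have msh : measurable_fun setT sh by exact: measurable_funB.
apply: (@lebesgue_measure_unique _ (pushforward mu sh)) => //.
move=> _ [[a b] _ <-] /=; rewrite /pushforward /sh.
rewrite (_ : _ @^-1` _ = `[(t - b), (t - a)[%classic); last first.
  by apply/seteqP; split=> x /=; rewrite !in_itv/= => /andP[? ?]; apply/andP; split; lra.
rewrite !lebesgue_measure_itv/= !lte_fin ltrD2l ltrN2; case: ifP => // _; congr EFin; ring.
Qed.

Section coordinates.
Context d (Y : measurableType d) (m : {measure set Y -> \bar R}).
Variables (x : Y -> R) (hx : lebesgue_distributed m x).

Lemma distributed_shift (t : R) : lebesgue_distributed m (fun y => x y - t).
Proof.
split=> [|A mA]; first by apply: measurable_funB => //; exact: hx.1.
rewrite (lebesgue_measure_shift t)// hx.2//.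
by rewrite -[X in measurable X]setTI; exact: measurable_funB.
Qed.

Lemma distributed_reflect (t : R) : lebesgue_distributed m (fun y => t - x y).
Proof.
split=> [|A mA]; first by apply: measurable_funB => //; exact: hx.1.
rewrite (lebesgue_measure_reflect t)// hx.2//.
by rewrite -[X in measurable X]setTI; exact: measurable_funB.
Qed.

(** Two Lebesgue-distributed coordinates give the same integral to a Borel
    function; applied to [t - x] and [x - t] this is the change of variables
    needed for convolutions. *)
Lemma transport2 (p : Y -> R) (f : R -> R) : lebesgue_distributed m p ->
  measurable_fun setT f -> m.-integrable setT (EFin \o (f \o x)) ->
  m.-integrable setT (EFin \o (f \o p)) /\
  \int[m]_y f (p y) = \int[m]_y f (x y).
Proof.
move=> hp mf ifx.
have imf := (integrable_transport hx mf).1 ifx.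
have ifp := (integrable_transport hp mf).2 imf.
by split=> //; rewrite (Rintegral_transport hp mf ifp) (Rintegral_transport hx mf ifx).
Qed.

Lemma cint_transport (p : Y -> R) (f : R -> R[i]) : lebesgue_distributed m p ->
  cmfun f -> cintegrable m (f \o x) ->
  cintegrable m (f \o p) /\ cint m (f \o p) = cint m (f \o x).
Proof.
move=> hp [mr mi] [ir ii].
have [r1 r2] := transport2 hp mr ir; have [i1 i2] := transport2 hp mi ii.
by split; [split|apply: complex_ext].
Qed.

End coordinates.

End lebesgue_transport.

(** * Laplace transforms and convolutions *)

Section kernel.
Context {R : realType}.

Lemma Re_opp_realM (t : R) (s : R[i]) : Re (- (t%:C * s)) = - (t * Re s).
Proof. by rewrite ReN ReM /= mul0r subr0. Qed.

Lemma Im_opp_realM (t : R) (s : R[i]) : Im (- (t%:C * s)) = - (t * Im s).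
Proof. by rewrite ImN ImM /= mul0r addr0. Qed.

Lemma Re_kernel (t : R) (s : R[i]) :
  Re (cexp (- (t%:C * s))) = expR (- (t * Re s)) * cos (t * Im s).
Proof. by rewrite Re_cexp Re_opp_realM Im_opp_realM cosN. Qed.

Lemma Im_kernel (t : R) (s : R[i]) :
  Im (cexp (- (t%:C * s))) = - (expR (- (t * Re s)) * sin (t * Im s)).
Proof. by rewrite Im_cexp Re_opp_realM Im_opp_realM sinN mulrN. Qed.

Lemma cmfun_kernel d (Y : measurableType d) (f : Y -> R) (s : R[i]) :
  measurable_fun setT f -> cmfun (fun y => cexp (- ((f y)%:C * s))).
Proof.
move=> mf; have mfM (k : R) : measurable_fun setT (fun y => f y * k).
  by exact: measurable_funM.
have me := continuous_measurable_fun (@continuous_expR R).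
have mc := continuous_measurable_fun (@continuous_cos R).
have ms := continuous_measurable_fun (@continuous_sin R).
have mE : measurable_fun setT (fun y => expR (- (f y * Re s))).
  by apply: (measurableT_comp me); apply: measurableT_comp.
split.
  rewrite (_ : _ \o _ = fun y =>
      expR (- (f y * Re s)) * cos (f y * Im s)); last first.
    by apply/funext => y /=; rewrite Re_kernel.
  by apply: measurable_funM => //; exact: (measurableT_comp mc).
rewrite (_ : _ \o _ = fun y =>
    - (expR (- (f y * Re s)) * sin (f y * Im s))); last first.
  by apply/funext => y /=; rewrite Im_kernel.
by apply: measurableT_comp => //; apply: measurable_funM => //;
  exact: (measurableT_comp ms).
Qed.

Lemma normc_kernel (z : R[i]) (t : R) (s : R[i]) :
  normc (z * cexp (- (t%:C * s))) = normc z * expR (- Re s * t).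
Proof. by rewrite Normc.normcM normc_cexp Re_opp_realM mulNr (mulrC t). Qed.

End kernel.

Section laplace.
Context {R : realType} d (Y : measurableType d).
Context (m : {sigma_finite_measure set Y -> \bar R}) (x : Y -> R).
Hypothesis hx : lebesgue_distributed m x.

Let mx : measurable_fun setT x. Proof. exact: hx.1. Qed.

(** Functions supported on the half-line with all exponential moments; their
    Laplace transforms are entire. *)
Definition expintegrable (g : Y -> R[i]) : Prop :=
  [/\ cmfun g, forall y, x y < 0 -> g y = 0 &
      forall C : R,
        m.-integrable setT (EFin \o (fun y => normc (g y) * expR (C * x y)))].

Definition laplace (g : Y -> R[i]) (s : R[i]) : R[i] :=
  cint m (fun y => g y * cexp (- ((x y)%:C * s))).

Lemma kernel_integrable (g : Y -> R[i]) (s : R[i]) : expintegrable g ->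
  cintegrable m (fun y => g y * cexp (- ((x y)%:C * s))).
Proof.
move=> [mg _ ig]; apply: (le_cintegrable _ (ig (- Re s))).
  by apply: cmfunM => //; exact: cmfun_kernel.
by move=> t; rewrite normc_kernel.
Qed.

Lemma kernel0 (z : R[i]) (t : R) : z * cexp (- (t%:C * 0)) = z.
Proof. by rewrite mulr0 oppr0 cexp0 mulr1. Qed.

Lemma expintegrable_cintegrable (g : Y -> R[i]) : expintegrable g -> cintegrable m g.
Proof.
move=> /(kernel_integrable 0).
by under eq_fun do rewrite kernel0.
Qed.

Lemma laplace0 (g : Y -> R[i]) : laplace g 0 = cint m g.
Proof. by apply: eq_cint => t; rewrite kernel0. Qed.

Definition conv (g : Y -> R[i]) (f : R -> R[i]) (u : R) : R[i] :=
  cint m (fun y => g y * f (u - x y)).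

Lemma cmfun_comp (f : R -> R[i]) (p : Y -> R) :
  cmfun f -> measurable_fun setT p -> cmfun (f \o p).
Proof.
by move=> [mr mi] mp; split; [exact: (measurableT_comp mr mp)|exact: (measurableT_comp mi mp)].
Qed.

Lemma conv_integrable (g : Y -> R[i]) (f : R -> R[i]) (M : R) (u : R) :
  expintegrable g -> cmfun f -> (forall v, normc (f v) <= M) ->
  cintegrable m (fun y => g y * f (u - x y)).
Proof.
move=> eg mf fM; have ig := expintegrable_cintegrable eg.
apply: (@le_cintegrable _ _ _ _ _ (fun t => M * normc (g t))).
- apply: cmfunM; first by case: eg.
  by apply: (cmfun_comp mf); exact: (distributed_reflect hx u).1.
- exact: (integrableZl _ _ (cintegrable_normc ig)).
- by move=> t; rewrite Normc.normcM mulrC ler_wpM2r// normc_ge0.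
Qed.

(** Fubini applied to [g(t) f(u - t) exp(-u s)]: translating the inner
    integral in [u] by [x t] splits the kernel into a product. *)
Lemma laplace_conv (g : Y -> R[i]) (f : R -> R[i]) (M : R) (s : R[i]) :
  expintegrable g -> cmfun f -> expintegrable (f \o x) ->
  (forall v, normc (f v) <= M) ->
  cintegrable m (fun y => conv g f (x y) * cexp (- ((x y)%:C * s))) /\
  laplace (conv g f \o x) s = laplace g s * laplace (f \o x) s.
Proof.
move=> eg mf ef fM.
pose fs (v : R) := f v * cexp (- (v%:C * s)).
have mfs : cmfun fs by apply: cmfunM => //; exact: cmfun_kernel.
have ifs : cintegrable m (fs \o x) by exact: kernel_integrable.
pose gs (y : Y) := g y * cexp (- ((x y)%:C * s)).
have igs : cintegrable m gs by exact: kernel_integrable.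
pose F (z : Y * Y) : R[i] :=
  g z.1 * f (x z.2 - x z.1) * cexp (- ((x z.2)%:C * s)).
have FE t u : F (t, u) = gs t * fs (x u - x t).
  rewrite /F /gs /fs /= -!mulrA; congr (_ * _); rewrite mulrCA; congr (_ * _).
  by rewrite -cexpD; congr cexp; rewrite rmorphB/=; ring.
have m1 : measurable_fun setT (fun z : Y * Y => x z.1).
  exact: (measurableT_comp mx measurable_fst).
have m2 : measurable_fun setT (fun z : Y * Y => x z.2).
  exact: (measurableT_comp mx measurable_snd).
have mF : cmfun F.
  apply: cmfunM; last exact: cmfun_kernel.
  apply: cmfunM.
    by case: eg => -[mr mi] _ _; split;
      [exact: (measurableT_comp mr measurable_fst)|
       exact: (measurableT_comp mi measurable_fst)].
  have mb := measurable_funB m2 m1.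
  by case: mf => mr mi; split; [exact: (measurableT_comp mr mb)|exact: (measurableT_comp mi mb)].
have sh t := cint_transport hx (distributed_shift hx (x t)) mfs ifs.
have F1 t : cintegrable m (fun u => F (t, u)).
  rewrite (_ : (fun u => _) = (fun u => gs t * fs (x u - x t))).
    by apply: cintegrableZ; exact: (sh t).1.
  by apply/funext => u; rewrite FE.
have F2 u : cintegrable m (fun t => F (t, u)).
  rewrite (_ : (fun t => _) = (fun t => cexp (- ((x u)%:C * s)) * (g t * f (x u - x t)))).
    by apply: cintegrableZ; exact: (conv_integrable _ eg mf fM).
  by apply/funext => t; rewrite /F /= mulrC.
have nfs : measurable_fun setT (normc \o fs) by exact: cmfun_normc.
have infs : m.-integrable setT (EFin \o ((normc \o fs) \o x)).
  exact: cintegrable_normc ifs.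
pose K := \int[m]_v normc (fs (x v)).
have ih : m.-integrable setT (EFin \o (fun t => K * normc (gs t))).
  exact: (integrableZl _ _ (cintegrable_normc igs)).
have Fh t : \int[m]_u normc (F (t, u)) <= K * normc (gs t).
  under eq_Rintegral do rewrite FE Normc.normcM.
  have [i2 E2] := transport2 hx (distributed_shift hx (x t)) nfs infs.
  by rewrite RintegralZl// mulrC /K -[X in _ <= X * _]E2.
have [_ c2 c3] := cint_fubini mF F1 ih Fh F2.
have E u : cint m (fun t => F (t, u)) = conv g f (x u) * cexp (- ((x u)%:C * s)).
  rewrite /conv mulrC -cintZ; last exact: (conv_integrable _ eg mf fM).
  by apply: eq_cint => t; rewrite /F /= mulrC.
split; first by move: c2; under eq_fun do rewrite E.
rewrite {1}/laplace -(eq_cint _ E) -c3.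
rewrite (@eq_cint _ _ _ _ _ (fun t => laplace (f \o x) s * gs t)); last first.
  move=> t; rewrite (@eq_cint _ _ _ _ _ (fun u => gs t * fs (x u - x t))).
    apply: (etrans (cintZ (gs t) (sh t).1)).
    exact: (etrans (mulrC _ _) (congr1 (fun z => z * gs t) (sh t).2)).
  by move=> u; rewrite FE.
exact: (etrans (cintZ _ igs) (mulrC _ _)).
Qed.

End laplace.

(** * The transform of a tail integral *)

Section window.
Context {R : realType}.
Local Notation mu := (@lebesgue_measure R).

Definition window (t u : R) : R := ((0 < u) && (u <= t))%:R.

Lemma measurable_window d (Y : measurableType d) (f g : Y -> R) :
  measurable_fun setT f -> measurable_fun setT g ->
  measurable_fun setT (fun y => window (f y) (g y)).
Proof.
move=> mf mg.
rewrite (_ : (fun y => _) = (fun y => if (0 < g y) && (g y <= f y) then cst 1 y else cst 0 y)).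
  apply: measurable_fun_if => //; apply: measurable_and.
    exact: measurable_fun_ltr.
  exact: measurable_fun_ler.
by apply/funext => y; rewrite /window; case: ifP.
Qed.

Section FTC.
Context d (Y : measurableType d) (m : {measure set Y -> \bar R}) (x : Y -> R).
Hypothesis hx : lebesgue_distributed m x.

(** The fundamental theorem of calculus on [(0, t]], read off on a measure
    space with a Lebesgue-distributed coordinate. *)
Lemma window_FTC (F f : R -> R) (t : R) : 0 <= t ->
  (forall v : R, is_derive v (1 : R) F (f v)) -> continuous f ->
  m.-integrable setT (EFin \o (fun y => window t (x y) * f (x y))) /\
  \int[m]_y (window t (x y) * f (x y)) = F t - F 0.
Proof.
move=> t0 dF cf.
have mf := continuous_measurable_fun cf.
pose wf u := window t u * f u.
have mw : measurable_fun setT wf.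
  by apply: measurable_funM => //; exact: measurable_window.
have wE : wf = f \_ `]0, t].
  apply/funext => u; rewrite patchE /wf /window; case: ifPn => [|].
    by rewrite inE/= in_itv/= => ->; rewrite mul1r.
  by rewrite notin_setE/= in_itv/= => /negP/negbTE->; rewrite mul0r.
have icc : mu.-integrable `[0, t] (EFin \o f).
  apply: continuous_compact_integrable => //; first exact: segment_compact.
  exact: continuous_subspaceT.
have ioc : mu.-integrable `]0, t] (EFin \o f).
  by apply: integrableS icc => //; exact: subset_itv_oc_cc.
have imu : mu.-integrable setT (EFin \o wf).
  rewrite wE -restrict_EFin; apply/integrable_restrict => //=.
  by rewrite setTI.
have im := (integrable_transport hx mw).2 imu.
split=> //; rewrite [LHS](Rintegral_transport hx mw im) wE.
rewrite -Rintegral_mkcond.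
rewrite Rintegral_itv_obnd_cbnd//.
move: t0; rewrite le_eqVlt => /predU1P[<-|t0].
  by rewrite set_itv1 Rintegral_set1 subrr.
have Fc (v : R) : {for v, continuous F}.
  by apply/differentiable_continuous/derivable1_diffP; have [] := dF v.
rewrite /Rintegral (@continuous_FTC2 _ _ F)//.
- exact: continuous_subspaceT.
- split.
  + by move=> v _; have [] := dF v.
  + by apply: cvg_at_right_filter; exact: Fc.
  + by apply: cvg_at_left_filter; exact: Fc.
- by move=> v _; rewrite derive1E; have [_ ->] := dF v.
Qed.

End FTC.
End window.

(** * Derivatives of the Laplace kernel *)

Section kernel_derivative.
Context {R : realType}.
Implicit Types (z w : R[i]) (r t : R).

Lemma is_derive_Re_kernel z r :
  is_derive r (1 : R) (fun r => Re (cexp (- (r%:C * z))))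
    (Re (- z * cexp (- (r%:C * z)))).
Proof.
rewrite (_ : (fun _ => _) = fun r => expR (- (r * Re z)) * cos (r * Im z)); last first.
  by apply/funext => v; rewrite Re_kernel.
apply: is_derive_eq.
by rewrite ReM ReN ImN Re_kernel Im_kernel /GRing.scale /=; ring.
Qed.

Lemma is_derive_Im_kernel z r :
  is_derive r (1 : R) (fun r => Im (cexp (- (r%:C * z))))
    (Im (- z * cexp (- (r%:C * z)))).
Proof.
rewrite (_ : (fun _ => _) = fun r => - (expR (- (r * Re z)) * sin (r * Im z))); last first.
  by apply/funext => v; rewrite Im_kernel.
apply: is_derive_eq.
by rewrite ImM ReN ImN Re_kernel Im_kernel /GRing.scale /=; ring.
Qed.

Lemma is_derive_Re_kernelM w z r :
  is_derive r (1 : R) (fun r => Re (w * cexp (- (r%:C * z))))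
    (Re (w * (- z * cexp (- (r%:C * z))))).
Proof.
rewrite (_ : (fun _ => _) = fun r => Re w * Re (cexp (- (r%:C * z))) -
   Im w * Im (cexp (- (r%:C * z)))); last by apply/funext => v; rewrite ReM.
have h1 := is_derive_Re_kernel z r.
have h2 := is_derive_Im_kernel z r.
by apply: is_derive_eq; rewrite [RHS]ReM /GRing.scale /=; ring.
Qed.

Lemma is_derive_Im_kernelM w z r :
  is_derive r (1 : R) (fun r => Im (w * cexp (- (r%:C * z))))
    (Im (w * (- z * cexp (- (r%:C * z))))).
Proof.
rewrite (_ : (fun _ => _) = fun r => Re w * Im (cexp (- (r%:C * z))) +
   Im w * Re (cexp (- (r%:C * z)))); last by apply/funext => v; rewrite ImM.
have h1 := is_derive_Re_kernel z r.
have h2 := is_derive_Im_kernel z r.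
by apply: is_derive_eq; rewrite [RHS]ImM /GRing.scale /=; ring.
Qed.

Lemma is_derive_continuous (f : R -> R) (df : R -> R) :
  (forall r, is_derive r (1 : R) f (df r)) -> continuous f.
Proof.
by move=> h r; apply/differentiable_continuous/derivable1_diffP; have [] := h r.
Qed.

End kernel_derivative.

Section tail.
Context {R : realType} d (Y : measurableType d).
Context (m : {sigma_finite_measure set Y -> \bar R}) (x : Y -> R).
Hypothesis hx : lebesgue_distributed m x.

Let mx : measurable_fun setT x. Proof. exact: hx.1. Qed.

Lemma window_integrable (t : R) : 0 <= t ->
  m.-integrable setT (EFin \o (fun y => window t (x y))) /\
  \int[m]_y window t (x y) = t.
Proof.
move=> t0.
have c1 : continuous (cst 1 : R -> R) by move=> ?; exact: cst_continuous.
have [] := @window_FTC _ _ _ _ _ hx id (cst 1) t t0 _ c1.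
rewrite (_ : (fun y => window t (x y) * _) = (fun y => window t (x y))); last first.
  by apply/funext => y; rewrite mulr1.
by rewrite subr0.
Qed.

Lemma window_ge0 (t u : R) : 0 <= window t u.
Proof. by rewrite /window ler0n. Qed.

Lemma window_kernel_bound (t u : R) (s : R[i]) :
  normc ((window t u)%:C * cexp (- (u%:C * s))) <=
  window t u * expR (`|Re s| * t).
Proof.
rewrite normc_kernel normc_real ger0_norm ?window_ge0// /window.
case: (boolP (_ && _)) => [/andP[u0 ut]|_]; rewrite ?mul1r ?mul0r// ler_expR.
rewrite (le_trans (ler_norm _))// normrM normrN (gtr0_norm u0).
by rewrite ler_wpM2l.
Qed.

Lemma window_kernel_integrable (t : R) (s : R[i]) : 0 <= t ->
  cintegrable m (fun y => (window t (x y))%:C * cexp (- ((x y)%:C * s))).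
Proof.
move=> t0; have [iw _] := window_integrable t0.
apply: (@le_cintegrable _ _ _ _ _ (fun y => window t (x y) * expR (`|Re s| * t))).
- apply: cmfunM; last exact: cmfun_kernel.
  apply: cmfun_real; exact: measurable_window.
- exact: (integrableZr _ _ iw).
- by move=> y; exact: window_kernel_bound.
Qed.

(** A primitive of [s exp(-u s)] is [- exp(-u s)]. The factor [s] is kept on
    the left so that the identity also covers [s = 0]. *)
Lemma window_kernel_cint (t : R) (s : R[i]) : 0 <= t ->
  s * cint m (fun y => (window t (x y))%:C * cexp (- ((x y)%:C * s))) =
  1 - cexp (- (t%:C * s)).
Proof.
move=> t0; have iw := window_kernel_integrable s t0.
rewrite -cintZ//.
have E y : s * ((window t (x y))%:C * cexp (- ((x y)%:C * s))) =
  (window t (x y))%:C * (-1 * (- s * cexp (- ((x y)%:C * s)))).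
  by rewrite mulrCA mulN1r mulNr opprK.
rewrite (eq_cint _ E).
have dR v := is_derive_Re_kernelM (-1) s v.
have dI v := is_derive_Im_kernelM (-1) s v.
have cR : continuous (fun v : R => Re (-1 * (- s * cexp (- (v%:C * s))))).
  apply: (@is_derive_continuous _ _ (fun v => Re (-1 * (- s) * (- s * cexp (- (v%:C * s)))))) => v.
  rewrite (_ : (fun v => _) = (fun v : R => Re (-1 * (- s) * cexp (- (v%:C * s))))).
    exact: is_derive_Re_kernelM.
  by apply/funext => v'; rewrite mulrA.
have cI : continuous (fun v : R => Im (-1 * (- s * cexp (- (v%:C * s))))).
  apply: (@is_derive_continuous _ _ (fun v => Im (-1 * (- s) * (- s * cexp (- (v%:C * s)))))) => v.
  rewrite (_ : (fun v => _) = (fun v : R => Im (-1 * (- s) * cexp (- (v%:C * s))))).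
    exact: is_derive_Im_kernelM.
  by apply/funext => v'; rewrite mulrA.
have [_ r2] := window_FTC hx t0 dR cR.
have [_ i2] := window_FTC hx t0 dI cI.
apply: complex_ext => /=.
  under eq_Rintegral do rewrite ReM /= mul0r subr0.
  by rewrite r2 rmorph0 mul0r oppr0 cexp0 mulN1r mulr1 ReD !ReN /= opprK addrC.
under eq_Rintegral do rewrite ImM /= mul0r addr0.
by rewrite i2 rmorph0 mul0r oppr0 cexp0 mulN1r mulr1 ImD !ImN /= opprK addrC.
Qed.

(** The tail integral of [g] beyond [u], set to [0] for [u <= 0] so that it is
    again supported on the half-line. *)
Definition tail (g : Y -> R[i]) (u : R) : R[i] :=
  cint m (fun y => (window (x y) u)%:C * g y).

Lemma tail_integrable (g : Y -> R[i]) (u : R) : expintegrable m x g ->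
  cintegrable m (fun y => (window (x y) u)%:C * g y).
Proof.
move=> eg; have ig := cintegrable_normc (expintegrable_cintegrable hx eg).
apply: (le_cintegrable _ ig).
  apply: cmfunM; last by case: eg.
  apply: cmfun_real; exact: measurable_window.
move=> y; rewrite Normc.normcM normc_real ger0_norm ?window_ge0// /window.
by case: (_ && _); rewrite ?mul1r// mul0r normc_ge0.
Qed.

(** By Fubini, integrating [exp(-u s)] over [0 < u <= t] first. The tail takes
    the place of the primitive of [g], whose transform would exist in a
    half-plane only. *)
Lemma laplace_tail (g : Y -> R[i]) (s : R[i]) : expintegrable m x g ->
  cintegrable m (fun y => tail g (x y) * cexp (- ((x y)%:C * s))) /\
  s * laplace m x (tail g \o x) s = laplace m x g 0 - laplace m x g s.
Proof.
move=> eg; have [mg g0 ig] := eg.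
pose F (z : Y * Y) : R[i] :=
  (window (x z.1) (x z.2))%:C * g z.1 * cexp (- ((x z.2)%:C * s)).
have FE t u : F (t, u) =
    g t * ((window (x t) (x u))%:C * cexp (- ((x u)%:C * s))).
  by rewrite /F /= mulrAC mulrC mulrA.
have m1 : measurable_fun setT (fun z : Y * Y => x z.1).
  exact: (measurableT_comp mx measurable_fst).
have m2 : measurable_fun setT (fun z : Y * Y => x z.2).
  exact: (measurableT_comp mx measurable_snd).
have mF : cmfun F.
  apply: cmfunM; last exact: cmfun_kernel.
  apply: cmfunM.
    by apply: cmfun_real; exact: measurable_window.
  by case: mg => mr mi; split;
    [exact: (measurableT_comp mr measurable_fst)|
     exact: (measurableT_comp mi measurable_fst)].
have F1 t : cintegrable m (fun u => F (t, u)).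
  rewrite (eq_fun (FE t)); have [xt|xt] := leP 0 (x t).
    by apply: cintegrableZ; exact: window_kernel_integrable.
  rewrite g0//; under eq_fun do rewrite mul0r.
  by split; exact: integrable0.
have F2 u : cintegrable m (fun t => F (t, u)).
  rewrite (_ : (fun t => _) = (fun t =>
      cexp (- ((x u)%:C * s)) * ((window (x t) (x u))%:C * g t))).
    by apply: cintegrableZ; exact: tail_integrable.
  by apply/funext => t; rewrite /F /= mulrC.
pose h y := normc (g y) * expR ((`|Re s| + 1) * x y).
have ih : m.-integrable setT (EFin \o h) by exact: ig.
have Fh t : \int[m]_u normc (F (t, u)) <= h t.
  under eq_Rintegral do rewrite FE Normc.normcM.
  have [xt|xt] := leP 0 (x t); last first.
    rewrite /h g0// Normc.normc0 mul0r.
    by under eq_Rintegral do rewrite mul0r; rewrite Rintegral_cst// mul0r.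
  have [iw Iw] := window_integrable xt.
  have inw := cintegrable_normc (window_kernel_integrable s xt).
  rewrite [leLHS](RintegralZl (normc (g t)) measurableT inw).
  rewrite ler_wpM2l ?normc_ge0//.
  apply: (@le_trans _ _ (\int[m]_y (window (x t) (x y) * expR (`|Re s| * x t)))).
    apply: le_Rintegral => //; first exact: (integrableZr _ _ iw).
    by move=> y _; exact: window_kernel_bound.
  rewrite RintegralZr// Iw mulrDl mul1r expRD mulrC ler_wpM2l ?expR_ge0//.
  by rewrite (le_trans _ (expR_ge1Dx _))// lerDr.
have [_ c2 c3] := cint_fubini mF F1 ih Fh F2.
have E u : cint m (fun t => F (t, u)) = tail g (x u) * cexp (- ((x u)%:C * s)).
  rewrite /tail mulrC -cintZ; last exact: tail_integrable.
  by apply: eq_cint => t; rewrite /F /= mulrC.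
split; first by move: c2; under eq_fun do rewrite E.
rewrite {1}/laplace -(eq_cint _ E) -c3.
have i1 := expintegrable_cintegrable hx eg.
have i2 := kernel_integrable hx s eg.
have [c1 _ _] := cint_fubini mF F1 ih Fh F2.
apply: (etrans (esym (cintZ s c1))).
rewrite (@eq_cint _ _ _ _ _ (fun t => g t + - (g t * cexp (- ((x t)%:C * s))))).
  by rewrite (cintD i1 (cintegrableN i2)) (cintN i2) laplace0.
move=> t; rewrite (eq_cint _ (FE t)).
have [xt|xt] := leP 0 (x t).
  rewrite cintZ; last exact: window_kernel_integrable.
  rewrite mulrCA (window_kernel_cint s xt) mulrBr mulr1; reflexivity.
rewrite (g0 _ xt) mul0r oppr0 addr0 (@eq_cint _ _ _ _ _ (fun=> 0)).
  rewrite cint0 mulr0; reflexivity.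
by move=> y; rewrite mul0r.
Qed.

End tail.

(** * Differentiating a Laplace transform along a ray *)

Section complex_derivative.
Context {R : realType}.

Definition cderive (f : R -> R[i]) (r : R) (z : R[i]) : Prop :=
  is_derive r (1 : R) (Re \o f) (Re z) /\ is_derive r (1 : R) (Im \o f) (Im z).

Lemma cderiveM (f g : R -> R[i]) (r : R) (z w : R[i]) :
  cderive f r z -> cderive g r w ->
  cderive (fun r => f r * g r) r (z * g r + f r * w).
Proof.
move=> [f1 f2] [g1 g2]; split.
  rewrite (_ : _ \o _ = ((Re \o f) * (Re \o g) - (Im \o f) * (Im \o g))); last first.
    by apply/funext => v; rewrite /= ReM.
  apply: (is_derive_eq (is_deriveB (is_deriveM f1 g1) (is_deriveM f2 g2))).
  by rewrite ReD !ReM /GRing.scale /=; ring.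
rewrite (_ : _ \o _ = ((Re \o f) * (Im \o g) + (Im \o f) * (Re \o g))); last first.
  by apply/funext => v; rewrite /= ImM.
by apply: is_derive_eq; rewrite ImD !ImM /GRing.scale /=; ring.
Qed.

Lemma cderiveD (f g : R -> R[i]) (r : R) (z w : R[i]) :
  cderive f r z -> cderive g r w -> cderive (fun r => f r + g r) r (z + w).
Proof.
move=> [f1 f2] [g1 g2]; split.
  rewrite (_ : _ \o _ = (Re \o f) + (Re \o g)); last first.
    by apply/funext => v; rewrite /= ReD.
  by apply: (is_derive_eq (is_deriveD f1 g1)); rewrite ReD; reflexivity.
rewrite (_ : _ \o _ = (Im \o f) + (Im \o g)); last first.
  by apply/funext => v; rewrite /= ImD.
by apply: (is_derive_eq (is_deriveD f2 g2)); rewrite ImD; reflexivity.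
Qed.

Lemma cderive_cst (z : R[i]) (r : R) : cderive (fun=> z) r 0.
Proof. by split; exact: is_derive_cst. Qed.

Lemma cderive_id (r : R) : cderive (fun r => r%:C) r 1.
Proof. by split; [exact: is_derive_id|exact: is_derive_cst]. Qed.

(** [|J|^2 exp(2 h)] has derivative
    [(2 Re p - 2 Re p) |J|^2 exp(2 h) = 0]. Only the modulus is followed, so no
    complex logarithm or uniqueness theorem is involved. *)
Lemma normc_linear_ode (J p : R -> R[i]) (h : R -> R) :
  (forall r, cderive J r (p r * J r)) ->
  (forall r, is_derive r (1 : R) h (- Re (p r))) ->
  forall r r', normc (J r) * expR (h r) = normc (J r') * expR (h r').
Proof.
move=> dJ dh r r'.
apply/eqP; rewrite -(@eqrXn2 _ 2) ?mulr_ge0 ?normc_ge0 ?expR_ge0//; apply/eqP.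
pose N v := ((Re \o J) v ^+ 2 + (Im \o J) v ^+ 2) * expR (h v) ^+ 2.
have -> v : (normc (J v) * expR (h v)) ^+ 2 = N v by rewrite exprMn sqr_normcE.
have -> v : (normc (J v) * expR (h v)) ^+ 2 = N v by rewrite exprMn sqr_normcE.
apply: is_derive_0_is_cst => v.
have [d1 d2] := dJ v; have d3 := dh v.
apply: is_derive_eq.
by rewrite ReM ImM /GRing.scale /=; ring.
Qed.

End complex_derivative.

Section laplace_derivative.
Context {R : realType} d (Y : measurableType d).
Context (m : {sigma_finite_measure set Y -> \bar R}) (x : Y -> R).
Hypothesis hx : lebesgue_distributed m x.

Let mx : measurable_fun setT x. Proof. exact: hx.1. Qed.

Definition mulx (g : Y -> R[i]) (y : Y) : R[i] := (x y)%:C * g y.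

Lemma expintegrable_mulx (g : Y -> R[i]) : expintegrable m x g -> expintegrable m x (mulx g).
Proof.
move=> [mg g0 ig]; split.
- by apply: cmfunM => //; exact: cmfun_real.
- by move=> y xy; rewrite /mulx g0// mulr0.
- move=> C; apply: le_integrable (ig (C + 1)) => //.
    apply/measurable_EFinP; apply: measurable_funM.
      by apply: cmfun_normc; apply: cmfunM => //; exact: cmfun_real.
    apply: (measurableT_comp (continuous_measurable_fun (@continuous_expR R))).
    exact: measurable_funM.
  move=> y _ /=; rewrite lee_fin !ger0_norm ?mulr_ge0 ?normc_ge0 ?expR_ge0//.
  have [xy|xy] := leP 0 (x y); last by rewrite /mulx g0// mulr0 Normc.normc0 !mul0r.
  rewrite /mulx Normc.normcM normc_real ger0_norm// mulrDl mul1r expRD.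
  rewrite mulrAC mulrC ler_wpM2l ?normc_ge0// mulrC ler_wpM2l ?expR_ge0//.
  by rewrite (le_trans _ (expR_ge1Dx _))// lerDr.
Qed.

(** Differentiation under the integral sign on [(r - 1, r + 1)], where the
    derivative of the integrand is dominated by a constant times
    [|x g| exp(k x)] with [k = (|r| + 1) |Re w|]. *)
Lemma cderive_laplace (g : Y -> R[i]) (w : R[i]) (r : R) : expintegrable m x g ->
  cderive (fun r => laplace m x g (r%:C * w)) r
    (- w * laplace m x (mulx g) (r%:C * w)).
Proof.
move=> eg; have eg' := expintegrable_mulx eg.
pose f (r : R) y := g y * cexp (- (r%:C * ((x y)%:C * w))).
have fE v : (fun y => g y * cexp (- ((x y)%:C * (v%:C * w)))) = f v.
  by apply/funext => y; rewrite /f mulrCA.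
pose f' (r : R) y := g y * (- ((x y)%:C * w) * cexp (- (r%:C * ((x y)%:C * w)))).
have f'E v y : f' v y = - w * (mulx g y * cexp (- ((x y)%:C * (v%:C * w)))).
  rewrite /f' /mulx (mulrCA (x y)%:C v%:C).
  set e := cexp _; ring.
have intf v : cintegrable m (f v) by rewrite -fE; exact: kernel_integrable.
pose k := (`|r| + 1) * `|Re w|.
pose G y := normc w * (normc (mulx g y) * expR (k * x y)).
have G0 y : 0 <= G y by rewrite !mulr_ge0 ?normc_ge0 ?expR_ge0.
have iG : m.-integrable setT (EFin \o G).
  by have [_ _ ig] := eg'; exact: (integrableZl _ _ (ig k)).
have Gub v y : `]r - 1, r + 1[%classic v -> normc (f' v y) <= G y.
  rewrite /= in_itv/= => /andP[rv vr].
  rewrite f'E Normc.normcM cnormN normc_kernel ler_wpM2l ?normc_ge0//.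
  have [xy|xy] := leP 0 (x y); last first.
    by have [_ -> // _] := eg'; rewrite Normc.normc0 !mul0r.
  rewrite ler_wpM2l ?normc_ge0// ler_expR ler_wpM2r//.
  rewrite ReM /= mul0r subr0 (le_trans (ler_norm _))// normrN normrM.
  have /andP[r1 r2] : - `|r| <= r <= `|r| by rewrite -ler_norml.
  by rewrite ler_wpM2r// ler_norml; apply/andP; split; lra.
have Ir : `]r - 1, r + 1[%classic r.
  by rewrite /= in_itv/=; apply/andP; split; lra.
have key (P : R[i] -> R) :
    (forall z, `|P z| <= normc z) ->
    (forall v, m.-integrable setT (EFin \o (fun y => P (f v y)))) ->
    (forall v y, is_derive v (1 : R) (fun v => P (f v y)) (P (f' v y))) ->
    is_derive r (1 : R) (fun v => \int[m]_y P (f v y)) (\int[m]_y P (f' r y)).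
  move=> Pn Pi dP.
  pose fP v y := P (f v y).
  have d1 v y : partial1of2 fP v y = P (f' v y).
    by rewrite partial1of2E; have [_ ->] := dP v y.
  have derf v y : `]r - 1, r + 1[%classic v -> setT y -> derivable (fP ^~ y) v 1.
    by move=> _ _; have [] := dP v y.
  have ub v y : `]r - 1, r + 1[%classic v -> setT y -> `|partial1of2 fP v y| <= G y.
    by move=> Iv _; rewrite d1 (le_trans (Pn _))// Gub.
  have ii v : `]r - 1, r + 1[%classic v -> m.-integrable setT (EFin \o fP v).
    by move=> _; exact: Pi.
  apply: DeriveDef.
    exact: (derivable_under_integral measurableT Ir ii derf G0 iG ub).
  rewrite -derive1E.
  rewrite (differentiation_under_integral measurableT Ir ii derf G0 iG ub).
  by apply: eq_Rintegral => y _; rewrite d1.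
have ci : cintegrable m (fun y => mulx g y * cexp (- ((x y)%:C * (r%:C * w)))).
  exact: kernel_integrable.
have LE : - w * laplace m x (mulx g) (r%:C * w) = cint m (f' r).
  by rewrite (eq_cint _ (f'E r)); exact: (esym (cintZ _ ci)).
have FE : (fun v => laplace m x g (v%:C * w)) = (fun v => cint m (f v)).
  by apply/funext => v; rewrite /laplace fE.
rewrite LE FE; split.
  apply: (key Re) => [z|v|v y]; first exact: Re_le_normc.
    exact: (intf v).1.
  exact: is_derive_Re_kernelM.
apply: (key Im) => [z|v|v y]; first exact: Im_le_normc.
  exact: (intf v).2.
exact: is_derive_Im_kernelM.
Qed.

End laplace_derivative.

(** * The exponential formula *)

Section renewal.
Context {R : realType} d (Y : measurableType d).
Context (m : {sigma_finite_measure set Y -> \bar R}) (x : Y -> R).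
Hypothesis hx : lebesgue_distributed m x.
Local Notation L := (laplace m x).

Variables (psi : Y -> R[i]) (tau : R -> R[i]) (c : R[i]) (M : R).
Local Notation phi := (mulx x psi).
Hypothesis epsi : expintegrable m x psi.
Hypothesis mtau : cmfun tau.
Hypothesis etau : expintegrable m x (tau \o x).
Hypothesis tauM : forall u, normc (tau u) <= M.
Hypothesis renewal : forall u : R, u%:C * tau u =
  c * tail m x phi u - tail m x (tau \o x) u - conv m x phi tau u.
Hypothesis tau0 : L (tau \o x) 0 = c * L phi 0.

Let ephi : expintegrable m x phi. Proof. exact: expintegrable_mulx. Qed.

(** The transform of the renewal identity, multiplied by [s] to clear the
    denominators of the tails. Since multiplication by [x] is minus the
    derivative of the transform, this is a differential equation for
    [c + s L tau]. *)
Lemma laplace_renewal (s : R[i]) :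
  s * L (mulx x (tau \o x)) s =
  L (tau \o x) s - L phi s * (c + s * L (tau \o x) s).
Proof.
have [i1 e1] := laplace_tail hx s ephi.
have [i2 e2] := laplace_tail hx s etau.
have [i3 e3] := laplace_conv hx s ephi mtau etau tauM.
have E : L (mulx x (tau \o x)) s = c * L (tail m x phi \o x) s -
    L (tail m x (tau \o x) \o x) s - L phi s * L (tau \o x) s.
  have j1 := cintegrableZ c i1; have j2 := cintegrableN i2.
  have j3 := cintegrableN i3.
  have eD := cintD (cintegrableD j1 j2) j3.
  rewrite (cintD j1 j2) (cintZ c i1) (cintN i2) (cintN i3) in eD.
  rewrite -e3; apply: etrans eD.
  apply: eq_cint => y; rewrite /mulx /= renewal.
  set e := cexp _; ring.
rewrite E !mulrBr e2 mulrCA e1 tau0; ring.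
Qed.

(** Along the ray [r s] the function [J = c + r s L tau] satisfies [J' = p J]
    with [p = s L phi], and [L psi] has derivative [- p] because
    [phi = x psi]. Hence [|J|] is [|c|] times the exponential of the decrease
    of [Re (L psi)] from [r = 0] to [r = 1]. *)
Lemma laplace_exp (s : R[i]) :
  normc (c + s * L (tau \o x) s) =
  normc c * expR (Re (L psi 0) - Re (L psi s)).
Proof.
pose J (r : R) := c + r%:C * (s * L (tau \o x) (r%:C * s)).
pose p (r : R) := s * L phi (r%:C * s).
pose h (r : R) := Re (L psi (r%:C * s)).
have dJ r : cderive J r (p r * J r).
  have d1 := cderive_laplace hx s r etau.
  have d2 := cderiveM (cderive_cst s r) d1.
  have d3 := cderiveM (cderive_id r) d2.
  have d4 := cderiveD (cderive_cst c r) d3.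
  move: d4; rewrite (_ : 0 + _ = p r * J r) //.
  have := laplace_renewal (r%:C * s); rewrite /p /J.
  set a := L (mulx _ _) _; set b := L (tau \o x) _; set q := L phi _ => e.
  transitivity (s * (b - (r%:C * s * a))); first by ring.
  rewrite e; ring.
have dh r : is_derive r (1 : R) h (- Re (p r)).
  have [+ _] := cderive_laplace hx s r epsi.
  by rewrite mulNr ReN.
have := normc_linear_ode dJ dh 1 0.
rewrite /J /h rmorph0 rmorph1 !mul0r !mul1r addr0 => e.
apply: (mulIf (lt0r_neq0 (expR_gt0 (Re (L psi s))))).
rewrite e -mulrA -expRD subrK; reflexivity.
Qed.

End renewal.

(** * Transforms of superexponentially small functions *)

Section superexponential.
Context {R : realType}.
Local Notation mu := (@lebesgue_measure R).

(** Up to constants, an integrable majorant of the products [tau(u) exp(b u)];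
    its total mass is [1]. *)
Definition exp_density (u : R) : R := if 0 <= u then expR (- u) else 0.

Lemma measurable_exp_density : measurable_fun setT exp_density.
Proof.
apply: measurable_fun_if => //; first exact: measurable_fun_ler.
apply: measurable_funTS.
apply: (measurableT_comp (continuous_measurable_fun (@continuous_expR R))).
by apply: continuous_measurable_fun; exact: opp_continuous.
Qed.

Lemma exp_density_integral : (\int[mu]_u (exp_density u)%:E = 1)%E.
Proof.
have -> : (fun u => (exp_density u)%:E) = ((fun u => (expR (- u))%:E) \_ `[0%R, +oo[)%E.
  apply/funext => u; rewrite patchE /exp_density; case: ifPn => u0.
    by rewrite mem_set//= in_itv/= u0.
  by rewrite memNset//= in_itv/= andbT; exact/negP.
have dF (u : R) : is_derive u (1 : R) (fun u => - expR (- u)) (expR (- u)).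
  by apply: is_derive_eq; rewrite /GRing.scale /=; ring.
have cF := is_derive_continuous dF.
have dE (u : R) : is_derive u (1 : R) (fun u => expR (- u)) (- expR (- u)).
  by apply: is_derive_eq; rewrite /GRing.scale /=; ring.
have cE := is_derive_continuous dE.
rewrite -integral_mkcond.
rewrite (@ge0_continuous_FTC2y _ _ (fun u => - expR (- u)) 0 0).
- by rewrite oppr0 expR0 sub0e EFinN oppeK.
- by move=> u _; exact: expR_ge0.
- exact: continuous_subspaceT.
- by rewrite -oppr0; apply: cvgN; exact: cvgr_expR.
- by move=> u _; have [] := dF u.
- by apply: cvg_at_right_filter; exact: cF.
- by move=> u _; rewrite derive1E; have [_ ->] := dF u.
Qed.

Lemma exp_density_distributed d (Y : measurableType d)
    (m : {measure set Y -> \bar R}) (x : Y -> R) : lebesgue_distributed m x ->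
  m.-integrable setT (EFin \o (exp_density \o x)) /\ \int[m]_y exp_density (x y) = 1.
Proof.
move=> hx; have mh := measurable_exp_density.
have imu : mu.-integrable setT (EFin \o exp_density).
  apply/integrableP; split; first exact/measurable_EFinP.
  have -> : (fun u => `|(EFin \o exp_density) u|)%E = EFin \o exp_density.
    by apply/funext => u; rewrite /= /exp_density; case: ifP; rewrite ?normr0// ger0_norm ?expR_ge0.
  by rewrite exp_density_integral ltry.
have im := (integrable_transport hx mh).2 imu.
by split=> //; rewrite [LHS](Rintegral_transport hx mh im) /Rintegral exp_density_integral.
Qed.

(** The left-hand side is largest at [ln u = A B - 1]; the inequality is
    [1 + y <= exp y] at [y = A B - ln u]. *)
Lemma xlnx_bound (A B u : R) : 0 < A -> 0 < u ->
  u * B - u / A * ln u <= expR (A * B) / A.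
Proof.
move=> A0 u0.
have -> : u * B - u / A * ln u = u * (A * B - ln u) / A by field; exact: lt0r_neq0.
rewrite ler_pM2r ?invr_gt0//.
have := expR_ge1Dx (A * B - ln u); rewrite expRB lnK ?posrE// ler_pdivlMr// mulrC.
by apply: le_trans; rewrite ler_wpM2l ?(ltW u0)// lerDr.
Qed.

Section decay.
Variables (tau : R -> R[i]) (A M u0 : R).
Hypotheses (A0 : 0 < A) (M0 : 0 <= M) (u0_gt0 : 0 < u0).
Hypothesis mtau : cmfun tau.
Hypothesis tau_neg : forall u, u < 0 -> tau u = 0.
Hypothesis tauM : forall u, normc (tau u) <= M.
Hypothesis tau_decay : forall u, u0 <= u ->
  normc (tau u) <= expR (- (u / A * ln u)).

(** The first term accounts for [u <= u0], where [tau] is only bounded, the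
    second for [u >= u0]. The exponent [b + 1] leaves a factor [exp(-u)] for
    integrability. *)
Definition decay_const (b : R) : R :=
  M * expR (u0 * (b + 1)) + expR (expR (A * (b + 1)) / A).

Lemma decay_bound (b u : R) : 0 <= b ->
  normc (tau u) * expR (b * u) <= decay_const b * exp_density u.
Proof.
move=> b0; rewrite /exp_density; case: ifPn => [u_ge0|]; last first.
  by rewrite -ltNge => u_lt0; rewrite tau_neg// Normc.normc0 !mul0r mulr0.
have -> : expR (b * u) = expR ((b + 1) * u) * expR (- u).
  by rewrite -expRD; congr expR; ring.
rewrite mulrA ler_wpM2r ?expR_ge0// /decay_const.
have [uu0|u0u] := ltP u u0.
  rewrite (@le_trans _ _ (M * expR (u0 * (b + 1))))// ?lerDl ?expR_ge0//.
  rewrite ler_pM ?normc_ge0 ?expR_ge0// ler_expR mulrC ler_wpM2r ?ltW//.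
  by rewrite ltr_wpDl.
rewrite (@le_trans _ _ (expR (expR (A * (b + 1)) / A)))//; last first.
  by rewrite lerDr mulr_ge0 ?expR_ge0.
apply: (@le_trans _ _ (expR (- (u / A * ln u)) * expR ((b + 1) * u))).
  by rewrite ler_wpM2r ?expR_ge0// tau_decay.
rewrite -expRD ler_expR addrC (mulrC _ u).
by apply: xlnx_bound => //; exact: lt_le_trans u0u.
Qed.

Context d (Y : measurableType d) (m : {sigma_finite_measure set Y -> \bar R}).
Variables (x : Y -> R) (hx : lebesgue_distributed m x).

Lemma expintegrable_decay : expintegrable m x (tau \o x).
Proof.
have [ih _] := exp_density_distributed hx.
have mx := hx.1.
split=> [|y xy|C]; first exact: cmfun_comp; first by rewrite /= tau_neg.
have mg : measurable_fun setT (fun y => normc (tau (x y)) * expR (C * x y)).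
  apply: measurable_funM.
    exact: (measurableT_comp (cmfun_normc mtau) mx).
  apply: (measurableT_comp (continuous_measurable_fun (@continuous_expR R))).
  exact: measurable_funM.
apply: (le_integrable measurableT _ _ (integrableZl measurableT (decay_const `|C|) ih)).
  exact/measurable_EFinP.
move=> y _ /=; rewrite lee_fin ger0_norm ?mulr_ge0 ?normc_ge0 ?expR_ge0//.
apply: (le_trans _ (ler_norm _)).
apply: (le_trans _ (decay_bound (x y) (normr_ge0 C))).
have [xy|xy] := leP 0 (x y); last by rewrite tau_neg// Normc.normc0 !mul0r.
by rewrite ler_wpM2l ?normc_ge0// ler_expR ler_wpM2r// ler_norm.
Qed.

Lemma laplace_decay (s : R[i]) (r : R) : 0 <= r -> normc s <= r ->
  normc (laplace m x (tau \o x) s) <= 2 * decay_const r.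
Proof.
move=> r0 sr; have [ih Ih] := exp_density_distributed hx.
have mx := hx.1.
have -> : decay_const r = \int[m]_y (decay_const r * exp_density (x y)).
  by rewrite RintegralZl// Ih mulr1.
apply: (@normc_cint_le _ _ _ _ _ (fun y => decay_const r * exp_density (x y))).
- by apply: cmfunM; [exact: cmfun_comp|exact: cmfun_kernel].
- exact: integrableZl ih.
- move=> y; rewrite normc_kernel; apply: (le_trans _ (decay_bound (x y) r0)).
  have [xy|xy] := leP 0 (x y); last by rewrite /= tau_neg// Normc.normc0 !mul0r.
  rewrite ler_wpM2l ?normc_ge0// ler_expR ler_wpM2r//.
  by rewrite (le_trans _ sr)// (le_trans _ (Re_le_normc _))// -normrN ler_norm.
Qed.

End decay.

End superexponential.

(** * A lower bound for the real part of the logarithm *)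

Section lower_bound.
Context {R : realType}.

(** [decay_const] grows like [exp(exp(A r))], so its logarithm is of order
    [exp(A r)]; the linear terms in [r] are absorbed into the same bound. *)
Lemma double_exp_log_bound (A M u0 a : R) :
  0 < A -> 0 <= M -> 0 < u0 -> 0 < a ->
  exists2 K, 0 <= K & forall r X : R, 0 <= r ->
    a * expR X <= a + r * (2 * decay_const A M u0 r) -> X <= K * expR (A * r).
Proof.
move=> A0 M0 u00 a0.
pose k := 2 * (M + 1) / a.
have k0 : 0 <= k by rewrite divr_ge0 ?(ltW a0)// mulr_ge0// addr_ge0.
exists (k / A + u0 / A + u0 + expR A / A).
  have [A0' u00'] := (ltW A0, ltW u00).
  do !apply: addr_ge0 => //; apply: divr_ge0 => //; exact: expR_ge0.
move=> r X r0; rewrite /decay_const.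
set p := u0 * (r + 1); set q := expR (A * (r + 1)) / A => H.
have p0 : 0 <= p by rewrite mulr_ge0 ?addr_ge0// ltW.
have q0 : 0 <= q by rewrite divr_ge0 ?expR_ge0 ?(ltW A0).
have e1 : 1 <= expR (p + q) by rewrite -expR0 ler_expR addr_ge0.
have e2 : expR p <= expR (p + q) by rewrite ler_expR lerDl.
have e3 : expR q <= expR (p + q) by rewrite ler_expR lerDr.
have : a * expR X <= a * (expR (k * r) * expR (p + q)).
  apply: (le_trans H).
  apply: (@le_trans _ _ (a * ((1 + k * r) * expR (p + q)))); last first.
    by rewrite ler_wpM2l ?(ltW a0) ?(ltW u00)// ler_wpM2r ?expR_ge0// expR_ge1Dx.
  have -> : a * ((1 + k * r) * expR (p + q)) =
      a * expR (p + q) + r * (2 * ((M + 1) * expR (p + q))).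
    by rewrite /k; field; exact: lt0r_neq0.
  rewrite lerD ?ler_peMr ?(ltW a0)// ler_wpM2l// ler_wpM2l// mulrDl mul1r.
  by rewrite lerD// ler_wpM2l.
rewrite ler_pM2l// -expRD ler_expR => /le_trans; apply.
have rE : r <= expR (A * r) / A.
  rewrite ler_pdivlMr// mulrC (le_trans _ (expR_ge1Dx _))// lerDr//.
have oE : 1 <= expR (A * r) by rewrite -expR0 ler_expR mulr_ge0// ltW.
have -> : p = u0 * r + u0 by rewrite /p mulrDr mulr1.
have -> : q = expR A / A * expR (A * r) by rewrite /q mulrDr mulr1 expRD; ring.
have i1 : k * r <= k / A * expR (A * r).
  by rewrite -mulrA ler_wpM2l// mulrC.
have i2 : u0 * r <= u0 / A * expR (A * r).
  by rewrite -mulrA ler_wpM2l ?(ltW a0) ?(ltW u00)// mulrC.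
have i3 : u0 <= u0 * expR (A * r) by rewrite ler_peMr ?(ltW u00).
rewrite !mulrDl; lra.
Qed.

Context d (Y : measurableType d).
Context (m : {sigma_finite_measure set Y -> \bar R}) (x : Y -> R).
Hypothesis hx : lebesgue_distributed m x.
Local Notation L := (laplace m x).

Variables (psi : Y -> R[i]) (tau : R -> R[i]) (c : R[i]) (A M u0 : R).
Local Notation phi := (mulx x psi).
Hypotheses (A0 : 0 < A) (M0 : 0 <= M) (u0_gt0 : 0 < u0) (c0 : c != 0).
Hypothesis epsi : expintegrable m x psi.
Hypothesis mtau : cmfun tau.
Hypothesis tau_neg : forall u, u < 0 -> tau u = 0.
Hypothesis tauM : forall u, normc (tau u) <= M.
Hypothesis tau_decay : forall u, u0 <= u ->
  normc (tau u) <= expR (- (u / A * ln u)).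
Hypothesis renewal : forall u : R, u%:C * tau u =
  c * tail m x phi u - tail m x (tau \o x) u - conv m x phi tau u.
Hypothesis tau0 : L (tau \o x) 0 = c * L phi 0.

(** By the exponential formula [exp(- Re (L psi s))] is a constant multiple of
    [|c + s L tau(s)|], which grows at most doubly exponentially. *)
Lemma laplace_lower_bound : exists2 K, 0 <= K &
  forall (r : R) (s : R[i]), 0 <= r -> normc s <= r ->
    - (K * expR (A * r)) <= Re (L psi s).
Proof.
have a0 : 0 < normc c.
  rewrite lt_neqAle normc_ge0 andbT eq_sym.
  by apply: contra c0 => /eqP/Normc.eq0_normc ->.
have [K K0 HK] := double_exp_log_bound A0 M0 u0_gt0 a0.
have etau := expintegrable_decay A0 M0 u0_gt0 mtau tau_neg tauM tau_decay hx.
exists (K + `|Re (L psi 0)|); first by rewrite addr_ge0.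
move=> r s r0 sr.
have := HK r (Re (L psi 0) - Re (L psi s)) r0.
rewrite -(laplace_exp hx epsi mtau etau tauM renewal tau0 s) => H.
have {}H := H (le_trans (cnormD _ _) _).
have {}H : Re (L psi 0) - Re (L psi s) <= K * expR (A * r).
  apply: H; rewrite lerD2l Normc.normcM ler_pM ?normc_ge0//.
  exact: laplace_decay.
have oE : 1 <= expR (A * r) by rewrite -expR0 ler_expR mulr_ge0// ltW.
have i1 : `|Re (L psi 0)| <= `|Re (L psi 0)| * expR (A * r) by rewrite ler_peMr.
have := ler_norm (- Re (L psi 0)); rewrite normrN => i2.
rewrite mulrDl; lra.
Qed.

End lower_bound.

(** * Averages of the exponential over roots of unity *)

Section circle.
Context {R : realType}.
Implicit Types (x al th : R) (n k N : nat).

Lemma derive_ge0_le (f f' : R -> R) x :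
  (forall v : R, is_derive v (1 : R) f (f' v)) ->
  (forall v, 0 <= v -> 0 <= f' v) -> 0 <= x -> f 0 <= f x.
Proof.
move=> df f'0 x0.
have dE (v : R) : derivable f v 1 /\ derive1 f v = f' v.
  by rewrite derive1E; have [? ->] := df v.
apply: (@ger0_derive1_le_cc _ f 0 x) => //.
- by move=> v; rewrite in_itv/= => /andP[v0 _]; rewrite (dE v).2 f'0// ltW.
- by apply: continuous_subspaceT; exact: is_derive_continuous df.
- by rewrite in_itv/= lexx.
- by rewrite in_itv/= lexx andbT.
Qed.

(** The Taylor polynomial at [0] of [x |-> Re (exp(x e^(i th)) e^(i al))]; the
    function itself is [expcos] below. *)
Definition cos_taylor th al n x : R :=
  \sum_(k < n) x ^+ k / k`!%:R * cos (k%:R * th + al).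

Lemma is_derive_cos_taylor th al n x :
  is_derive x (1 : R) (cos_taylor th al n.+1) (cos_taylor th (al + th) n x).
Proof.
rewrite /cos_taylor; elim: n => [|n IH].
  rewrite (_ : (fun _ => _) = cst (cos al)); last first.
    apply/funext => v /=.
    by rewrite big_ord1 expr0 fact0 divr1 mul1r mul0r add0r.
  by rewrite big_ord0; exact: is_derive_cst.
rewrite (_ : (fun _ => _) = (cos_taylor th al n.+1) +
    (fun v => v ^+ n.+1 / n.+1`!%:R * cos (n.+1%:R * th + al))); last first.
  by apply/funext => v; rewrite big_ord_recr.
rewrite big_ord_recr /=.
have IH' : is_derive x (1 : R) (cos_taylor th al n.+1) (cos_taylor th (al + th) n x) := IH.
have fE : n.+1`!%:R = n.+1%:R * n`!%:R :> R by rewrite -natrM factS.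
have f0 : n`!%:R != 0 :> R by rewrite pnatr_eq0 -lt0n fact_gt0.
have n0 : n.+1%:R != 0 :> R by rewrite pnatr_eq0.
have aE : n%:R * th + (al + th) = n.+1%:R * th + al :> R by rewrite -natr1; ring.
have dX : is_derive x (1 : R)
    (fun v => v ^+ n.+1 / n.+1`!%:R * cos (n.+1%:R * th + al))
    (x ^+ n / n`!%:R * cos (n%:R * th + (al + th))).
  rewrite (_ : (fun v => _) =
    (n.+1`!%:R^-1 * cos (n.+1%:R * th + al)) \*: ((@id R) ^+ n.+1)); last first.
    by apply/funext => v; rewrite /= exprfctE /GRing.scale /=; ring.
  have dXn := is_deriveX n.+1 (is_derive_id x (1 : R)).
  have dZ := is_deriveZ (n.+1`!%:R^-1 * cos (n.+1%:R * th + al)) dXn.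
  apply: is_derive_eq.
  by rewrite aE fE /GRing.scale /=; field; rewrite f0 /= nat1r n0.
exact: is_deriveD.
Qed.

Definition expcos th al x : R := expR (x * cos th) * cos (x * sin th + al).

Lemma is_derive_expcos th al x :
  is_derive x (1 : R) (expcos th al) (expcos th (al + th) x).
Proof.
rewrite /expcos; apply: is_derive_eq.
by rewrite /GRing.scale /= addrA (cosD (_ + _) th); ring.
Qed.

(** Induction on [n], for all phases [al] at once: differentiating in [x] adds
    [th] to the phase and lowers [n] by one, and the right-hand side is chosen
    so that its derivative is the bound for [n - 1]. The decay [2^-n] lets a
    limit in [n] be taken outside integrals against exponential moments. *)
Lemma expcos_taylor th al n x : 0 <= x ->
  expcos th al x - cos_taylor th al n x <= 2^-1 ^+ n * expR (2 * x).
Proof.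
elim: n al x => [|n IH] al x x0.
  rewrite /cos_taylor big_ord0 subr0 expr0 mul1r /expcos.
  apply: (@le_trans _ _ (expR (x * cos th))).
    by rewrite ler_piMr ?expR_ge0// cos_le1.
  by rewrite ler_expR mulrC ler_wpM2r// (le_trans (cos_le1 th))// ler1n.
pose f v := 2^-1 ^+ n.+1 * expR (2 * v) - expcos th al v + cos_taylor th al n.+1 v.
pose f' v := 2^-1 ^+ n * expR (2 * v) - expcos th (al + th) v + cos_taylor th (al + th) n v.
have df (v : R) : is_derive v (1 : R) f (f' v).
  rewrite /f /f'.
  have d1 := is_derive_cos_taylor th al n v.
  have d2 := is_derive_expcos th al v.
  have d3 : is_derive v (1 : R) (fun v => 2^-1 ^+ n.+1 * expR (2 * v))
      (2^-1 ^+ n * expR (2 * v)).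
    apply: is_derive_eq; rewrite exprS /GRing.scale /=.
    by field.
  exact: is_deriveD.
have f'0 v : 0 <= v -> 0 <= f' v.
  by move=> v0; have := IH (al + th) v v0; rewrite /f'; lra.
have := derive_ge0_le df f'0 x0.
rewrite {1}/f /expcos !(mulr0, mul0r) !expR0 add0r mul1r.
have -> : cos_taylor th al n.+1 0 = cos al.
  rewrite /cos_taylor big_ord_recl big1 ?addr0 => [|i _].
    by rewrite expr0 fact0 divr1 mul1r mul0r add0r.
  by rewrite exprS mul0r mul0r mul0r.
rewrite /f /expcos mulr1 subrK.
have : 0 <= 2^-1 ^+ n.+1 :> R by rewrite exprn_ge0// invr_ge0.
by move=> h1 h2; lra.
Qed.

(** The lower bound is the upper bound for the phase [al + pi]. *)
Lemma expcos_taylor_abs th al n x : 0 <= x ->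
  `|expcos th al x - cos_taylor th al n x| <= 2^-1 ^+ n * expR (2 * x).
Proof.
move=> x0; rewrite ler_norml expcos_taylor// andbT.
have := expcos_taylor th (al + pi) n x0.
have -> : expcos th (al + pi) x = - expcos th al x.
  by rewrite /expcos addrA cosDpi mulrN.
have -> : cos_taylor th (al + pi) n x = - cos_taylor th al n x.
  by rewrite /cos_taylor -sumrN; apply: eq_bigr => k _; rewrite addrA cosDpi mulrN.
by lra.
Qed.

Definition root_angle N (j : nat) : R := pi *+ 2 * j%:R / N%:R.

Lemma sinD2pin n x : sin (x + pi *+ 2 * n%:R) = sin x.
Proof. by rewrite mulr_natr (periodicn (@sinD2pi R)). Qed.

(** Multiplied by [2 sin(pi k / N)] the sum telescopes, and the boundary terms
    differ by a multiple of [2 pi]. *)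
Lemma sum_cos_roots N k al : (0 < k < N)%N ->
  \sum_(j < N) cos (k%:R * root_angle N j + al) = 0.
Proof.
move=> /andP[k0 kN].
(* half of the step of the arguments [k th_j] *)
pose h : R := pi * k%:R / N%:R.
have N0 : 0 < N%:R :> R by rewrite ltr0n (ltn_trans k0).
have hs : 0 < sin h.
  apply: sin_gt0_pi; apply/andP; split.
    by rewrite /h divr_gt0// mulr_gt0 ?pi_gt0 ?ltr0n.
  by rewrite /h ltr_pdivrMr// ltr_pM2l ?pi_gt0// ltr_nat.
have hE j : k%:R * root_angle N j + al = h * j%:R *+ 2 + al.
  by rewrite /root_angle /h; field; exact: lt0r_neq0.
have tele n : 2 * sin h * \sum_(j < n) cos (k%:R * root_angle N j + al) =
    sin (h * n%:R *+ 2 + al - h) - sin (al - h).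
  elim: n => [|n IH]; first by rewrite big_ord0 mulr0 mulr0 mul0rn add0r subrr.
  rewrite big_ord_recr /= mulrDr IH hE.
  have -> : h * n.+1%:R *+ 2 + al - h = (h * n%:R *+ 2 + al) + h.
    by rewrite -natr1; ring.
  by rewrite (sinD _ h) (sinB (_ + _) h); ring.
have := tele N.
have -> : h * N%:R *+ 2 + al - h = (al - h) + pi *+ 2 * k%:R.
  by rewrite /h; field; exact: lt0r_neq0.
rewrite sinD2pin subrr => /eqP; rewrite mulf_eq0 => /orP[|/eqP//].
by rewrite mulf_eq0 pnatr_eq0 /= (gt_eqF hs).
Qed.

(** A nonnegative weight on the [N]-th roots of unity whose only frequencies
    are [0] and [k]: averaging against it extracts the constant term minus half
    of the [k]-th one, and being nonnegative it preserves one-sided bounds. *)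
Definition cos_weight N k (j : nat) : R := 1 - cos (k%:R * root_angle N j).

Lemma cos_weight_ge0 N k j : 0 <= cos_weight N k j.
Proof. by rewrite subr_ge0 cos_le1. Qed.

Lemma cos_weight_le2 N k j : cos_weight N k j <= 2.
Proof. by rewrite lerBlDr; have := cos_geN1 (k%:R * root_angle N j); lra. Qed.

Lemma cos_weight_average N k i al : (0 < k)%N -> (i + k < N)%N ->
  N%:R^-1 * \sum_(j < N) cos_weight N k j * cos (i%:R * root_angle N j + al) =
  ((i == 0%N)%:R - (i == k)%:R / 2) * cos al.
Proof.
move=> k0 ikN.
have N0 : N%:R != 0 :> R by rewrite pnatr_eq0 -lt0n; apply: leq_ltn_trans ikN.
have avg be l : (l < N)%N ->
    N%:R^-1 * \sum_(j < N) cos (l%:R * root_angle N j + be) = (l == 0%N)%:R * cos be.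
  move=> lN; have [->|l0] := eqVneq l 0%N.
    under eq_bigr do rewrite mul0r add0r.
    by rewrite sumr_const card_ord -[cos be *+ N]mulr_natl mulrA mulVf.
  by rewrite sum_cos_roots ?lt0n ?l0// mulr0 mul0r.
have E j : cos_weight N k j * cos (i%:R * root_angle N j + al) =
    cos (i%:R * root_angle N j + al) -
    2^-1 * (cos ((i + k)%:R * root_angle N j + al) +
     (if (k <= i)%N then cos ((i - k)%:R * root_angle N j + al)
      else cos ((k - i)%:R * root_angle N j - al))).
  rewrite /cos_weight mulrBl mul1r; congr (_ - _).
  set t := root_angle N j.
  have -> : (if (k <= i)%N then cos ((i - k)%:R * t + al)
      else cos ((k - i)%:R * t - al)) = cos ((i%:R * t + al) - k%:R * t).
    case: ifPn => ki.
      by rewrite natrB//; congr cos; ring.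
    rewrite -ltnNge in ki.
    by rewrite natrB 1?ltnW// -cosN; congr cos; ring.
  have -> : (i + k)%:R * t + al = (i%:R * t + al) + k%:R * t by rewrite natrD; ring.
  by set v := i%:R * t + al; rewrite (cosD v) (cosB v); field.
under eq_bigr do rewrite E.
rewrite sumrB -mulr_sumr big_split /= mulrBr mulrCA mulrDr.
rewrite avg; last by apply: leq_ltn_trans ikN; exact: leq_addr.
rewrite avg// addn_eq0 (gtn_eqF k0) andbF mul0r add0r.
case: (leqP k i) => ki.
  rewrite avg; last by apply: leq_ltn_trans ikN; rewrite (leq_trans (leq_subr _ _)) ?leq_addr.
  have -> : (i == k) = (i <= k)%N by rewrite eqn_leq ki andbT.
  rewrite subn_eq0; ring.
rewrite avg; last by apply: leq_ltn_trans ikN; rewrite (leq_trans (leq_subr _ _)) ?leq_addl.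
by rewrite subn_eq0 [(k <= i)%N]leqNgt ki mul0r mulr0 subr0 (ltn_eqF ki) mul0r subr0.
Qed.

(** Replacing [expcos] by its Taylor polynomial of degree less than [n], no
    frequency up to [n + k - 1] aliases modulo [n + k], so that only the terms
    of index [0] and [k] survive the average. *)
Lemma cos_weight_expcos n k al x : (0 < k < n)%N -> 0 <= x ->
  `| (n + k)%:R^-1 *
       \sum_(j < n + k) cos_weight (n + k) k j * expcos (root_angle (n + k) j) al x
     - cos al * (1 - x ^+ k / (2 * k`!%:R)) |
  <= 2 * (2^-1 ^+ n * expR (2 * x)).
Proof.
move=> /andP[k0 kn] x0; set N := (n + k)%N.
have N0 : 0 < N%:R :> R by rewrite ltr0n /N addn_gt0 k0 orbT.
have -> : cos al * (1 - x ^+ k / (2 * k`!%:R)) = N%:R^-1 *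
    \sum_(j < N) cos_weight N k j * cos_taylor (root_angle N j) al n x.
  under eq_bigr => j _.
    rewrite /cos_taylor mulr_sumr.
    under eq_bigr => i _ do rewrite mulrCA.
    over.
  rewrite exchange_big /= mulr_sumr.
  under eq_bigr => i _.
    rewrite -mulr_sumr mulrCA cos_weight_average//; last by rewrite /N ltn_add2r.
    over.
  rewrite (bigD1 (Ordinal (leq_ltn_trans (leq0n k) kn))) //=.
  rewrite (bigD1 (Ordinal kn)) /=; last by rewrite -val_eqE /= -lt0n.
  rewrite big1 ?addr0 => [|i /andP[i0 ik]]; last first.
    move: i0 ik; rewrite -!val_eqE /= => /negbTE-> /negbTE->.
    by rewrite mul0r subrr mul0r mulr0.
  rewrite eqxx (gtn_eqF k0) (ltn_eqF k0) expr0 fact0 /= divr1 mul0r subr0 !mul1r sub0r.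
  have f0 : k`!%:R != 0 :> R by rewrite pnatr_eq0 -lt0n fact_gt0.
  by field; exact: f0.
have Ni0 : 0 <= N%:R^-1 :> R by rewrite invr_ge0 ltW.
rewrite -mulrBr -sumrB normrM (ger0_norm Ni0) ler_pdivrMl//.
rewrite (le_trans (ler_norm_sum _ _ _))//.
have -> : N%:R * (2 * (2^-1 ^+ n * expR (2 * x))) =
    \sum_(j < N) (2 * (2^-1 ^+ n * expR (2 * x))).
  by rewrite sumr_const card_ord mulr_natl.
apply: ler_sum => j _; rewrite -mulrBr normrM ler_pM//.
  by rewrite ger0_norm ?cos_weight_ge0// cos_weight_le2.
exact: expcos_taylor_abs.
Qed.

End circle.

(** * Moments from a one-sided bound on circles *)

Section borel_caratheodory.
Context {R : realType} d (Y : measurableType d).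
Context (m : {sigma_finite_measure set Y -> \bar R}) (x : Y -> R).
Hypothesis hx : lebesgue_distributed m x.
Local Notation L := (laplace m x).

Let mx : measurable_fun setT x. Proof. exact: hx.1. Qed.

Lemma le_geometric_eps (a b D : R) :
  (forall n, a <= b + 2^-1 ^+ n * D) -> a <= b.
Proof.
move=> H; apply/ler_addgt0Pr => e e0.
have [D0|D0] := leP D 0.
  apply: (le_trans (H 0%N)); rewrite expr0 mul1r lerD2l.
  by rewrite (le_trans D0)// ltW.
pose n := Num.bound (D / e).
have Dn : D / e < n%:R by rewrite archi_boundP// divr_ge0// ltW.
apply: (le_trans (H n)); rewrite lerD2l exprVn ler_pdivrMl ?exprn_gt0//.
rewrite ltW//; move: Dn; rewrite ltr_pdivrMr// => /lt_le_trans; apply.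
by rewrite ler_wpM2r ?(ltW e0)// -natrX ler_nat ltnW// ltn_expl.
Qed.

Lemma Rintegral_lincomb (f : nat -> Y -> R) (w : nat -> R) n :
  (forall j, m.-integrable setT (EFin \o f j)) ->
  m.-integrable setT (EFin \o (fun y => \sum_(j < n) w j * f j y)) /\
  \int[m]_y (\sum_(j < n) w j * f j y) = \sum_(j < n) w j * \int[m]_y f j y.
Proof.
move=> fi; have wfi j : m.-integrable setT (EFin \o (fun y => w j * f j y)).
  exact: integrableZl (fi j).
elim: n => [|n [IH1 IH2]].
  rewrite (_ : (fun y => _) = (fun=> 0)); last by apply/funext => y; rewrite big_ord0.
  by rewrite big_ord0 Rintegral_cst// mul0r; split=> //; exact: integrable0.
rewrite (_ : (fun y => _) = (fun y => \sum_(j < n) w j * f j y + w n * f n y)); last first.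
  by apply/funext => y; rewrite big_ord_recr.
split; first exact: (integrableD measurableT IH1 (wfi n)).
by rewrite (RintegralD measurableT IH1 (wfi n)) IH2 RintegralZl// big_ord_recr.
Qed.

Lemma exprn_fact_le_expR (v : R) k : 0 <= v -> v ^+ k / k`!%:R <= expR v.
Proof.
case: k => [|k] v0; first by rewrite expr0 fact0 divr1 -expR0 ler_expR.
by rewrite (le_trans _ (expR_ge1Dxn k v0))// lerDr.
Qed.

Variable psi : Y -> R[i].
Hypothesis epsi : expintegrable m x psi.

(** At [s = - r e^(i th)] the kernel is [exp(r x e^(i th))]; the phase
    [- pi / 2] turns its cosine into the sine of the imaginary part. *)
Lemma ReL_circle (r th : R) :
  m.-integrable setT (EFin \o (fun y => Re (psi y) * expcos th 0 (r * x y) -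
    Im (psi y) * expcos th (- (pi / 2)) (r * x y))) /\
  Re (L psi (- (r%:C * (cos th +i* sin th)))) =
  \int[m]_y (Re (psi y) * expcos th 0 (r * x y) -
    Im (psi y) * expcos th (- (pi / 2)) (r * x y)).
Proof.
set s := - (r%:C * _).
have E y : Re (psi y * cexp (- ((x y)%:C * s))) =
   Re (psi y) * expcos th 0 (r * x y) -
   Im (psi y) * expcos th (- (pi / 2)) (r * x y).
  rewrite ReM Re_kernel Im_kernel /s ReN ImN ReM ImM /= !mul0r subr0 addr0.
  rewrite /expcos addr0 cosBpihalf.
  have -> : - (x y * - (r * cos th)) = r * x y * cos th by ring.
  have -> : x y * - (r * sin th) = - (r * x y * sin th) by ring.
  by rewrite cosN sinN; ring.
have [i _] := kernel_integrable hx s epsi.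
split; first by move: i; rewrite (_ : _ \o _ = (fun y =>
   Re (psi y * cexp (- ((x y)%:C * s))))) //; under eq_fun do rewrite E.
by rewrite /laplace /=; under eq_Rintegral do rewrite E.
Qed.

Lemma moment_integrable (r : R) k : 0 <= r ->
  m.-integrable setT
    (EFin \o (fun y => Re (psi y) * ((r * x y) ^+ k / k`!%:R))).
Proof.
move=> r0; have [[mr _] p0 ip] := epsi.
apply: (le_integrable measurableT _ _ (ip r)).
  apply/measurable_EFinP; apply: measurable_funM => //.
  apply: measurable_funM => //; apply: measurable_funX; exact: measurable_funM.
move=> y _ /=; rewrite lee_fin.
have [xy|xy] := leP 0 (x y); last by rewrite p0//= mul0r normr0 normr_ge0.
have X0 : 0 <= r * x y by rewrite mulr_ge0.
apply: (le_trans _ (ler_norm _)); rewrite normrM ler_pM ?Re_le_normc//.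
by rewrite ger0_norm ?exprn_fact_le_expR// divr_ge0 ?exprn_ge0.
Qed.

Lemma cos_weight_pointwise (r : R) n k y : 0 <= r -> (0 < k < n)%N ->
  (n + k)%:R^-1 * \sum_(j < n + k) cos_weight (n + k) k j *
    (Re (psi y) * expcos (root_angle (n + k) j) 0 (r * x y) -
     Im (psi y) * expcos (root_angle (n + k) j) (- (pi / 2)) (r * x y)) <=
  Re (psi y) - 2^-1 * (Re (psi y) * ((r * x y) ^+ k / k`!%:R)) +
  2^-1 ^+ n * (4 * (normc (psi y) * expR (2 * r * x y))).
Proof.
move=> r0 kn; have [_ p0 _] := epsi.
have [xy|xy] := leP 0 (x y); last first.
  rewrite p0// Normc.normc0 /= !(mul0r, mulr0) subr0 addr0 big1 ?mulr0// => j _.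
  by rewrite !mul0r subrr mulr0.
have X0 : 0 <= r * x y by rewrite mulr_ge0.
have h0 := cos_weight_expcos 0 kn X0.
have h1 := cos_weight_expcos (- (pi / 2)) kn X0.
set p1 := Re (psi y); set p2 := Im (psi y); set N := (n + k)%N.
set a0 := N%:R^-1 * \sum_(j < N) cos_weight N k j * expcos (root_angle N j) 0 (r * x y) in h0.
set a1 := N%:R^-1 * \sum_(j < N) cos_weight N k j *
  expcos (root_angle N j) (- (pi / 2)) (r * x y) in h1.
have -> : N%:R^-1 * \sum_(j < N) cos_weight N k j *
    (p1 * expcos (root_angle N j) 0 (r * x y) -
     p2 * expcos (root_angle N j) (- (pi / 2)) (r * x y)) = p1 * a0 - p2 * a1.
  rewrite /a0 /a1 !mulr_sumr -sumrB; apply: eq_bigr => j _; ring.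
have k0 : k`!%:R != 0 :> R by rewrite pnatr_eq0 -lt0n fact_gt0.
rewrite cosN cos_pihalf mul0r subr0 in h1.
rewrite cos0 mul1r in h0.
rewrite (_ : 2 * r * x y = 2 * (r * x y)); last by rewrite mulrA.
set q := 2^-1 ^+ n * expR (2 * (r * x y)) in h0 h1.
have q0 : 0 <= q by rewrite mulr_ge0 ?expR_ge0 ?exprn_ge0 ?invr_ge0.
have b0 : p1 * (a0 - (1 - (r * x y) ^+ k / (2 * k`!%:R))) <= normc (psi y) * (2 * q).
  by rewrite (le_trans (ler_norm _))// normrM ler_pM// Re_le_normc.
have b1 : - (p2 * a1) <= normc (psi y) * (2 * q).
  by rewrite (le_trans (ler_norm _))// normrN normrM ler_pM// Im_le_normc.
have -> : 2^-1 ^+ n * (4 * (normc (psi y) * expR (2 * (r * x y)))) =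
    normc (psi y) * (2 * q) + normc (psi y) * (2 * q) by rewrite /q; ring.
have -> : p1 - 2^-1 * (p1 * ((r * x y) ^+ k / k`!%:R)) =
  p1 * (1 - (r * x y) ^+ k / (2 * k`!%:R)) by field.
rewrite mulrBr in b0; lra.
Qed.

Variables (A K : R).
Hypothesis K0 : 0 <= K.
Hypothesis lower : forall (r : R) (s : R[i]), 0 <= r -> normc s <= r ->
  - (K * expR (A * r)) <= Re (L psi s).

(** Borel-Caratheodory for the coefficients of the power series of
    [L psi (- z)]: the average over the circle of [Re (L psi)] against
    [1 - cos(k th)] is at least [- 2 K exp(A r)] and equals the constant
    coefficient minus half of the [k]-th one times [r^k], up to a discretization
    error that vanishes as the number of nodes grows. *)
Lemma moment_bound (r : R) k : 0 <= r -> (0 < k)%N ->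
  \int[m]_y (Re (psi y) * ((r * x y) ^+ k / k`!%:R)) <=
  2 * \int[m]_y Re (psi y) + 4 * (K * expR (A * r)).
Proof.
move=> r0 k0; have [_ _ ip] := epsi.
have [i1 _] := expintegrable_cintegrable hx epsi.
have ik := moment_integrable k r0.
have ie := ip (2 * r).
pose D := 8 * \int[m]_y (normc (psi y) * expR (2 * r * x y)).
apply: (@le_geometric_eps _ _ (2^-1 ^+ k.+1 * D)) => l.
(* [n > k] is needed for the [k]-th term to occur in the Taylor polynomial *)
pose n := (l + k.+1)%N; pose N := (n + k)%N.
have kn : (0 < k < n)%N by rewrite k0 /n addnS ltnS leq_addl.
have N0 : 0 < N%:R :> R by rewrite ltr0n /N addn_gt0 k0 orbT.
pose f j y := Re (psi y) * expcos (root_angle N j) 0 (r * x y) -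
     Im (psi y) * expcos (root_angle N j) (- (pi / 2)) (r * x y).
have fi j : m.-integrable setT (EFin \o f j) := (ReL_circle r (root_angle N j)).1.
have [si sE] := Rintegral_lincomb (cos_weight N k) N fi.
have lo : - (2 * (K * expR (A * r))) <=
    N%:R^-1 * \sum_(j < N) cos_weight N k j * \int[m]_y f j y.
  rewrite ler_pdivlMl// mulrN.
  have -> : N%:R * (2 * (K * expR (A * r))) =
      \sum_(j < N) (2 * (K * expR (A * r))).
    by rewrite sumr_const card_ord mulr_natl.
  rewrite -sumrN; apply: ler_sum => j _.
  rewrite -(ReL_circle r (root_angle N j)).2.
  have kE : 0 <= K * expR (A * r) by rewrite mulr_ge0 ?expR_ge0.
  have ns : normc (- (r%:C * (cos (root_angle N j) +i* sin (root_angle N j)))) <= r.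
    rewrite cnormN Normc.normcM normc_real ger0_norm// ler_piMr//.
    by rewrite /normc /= cos2Dsin2 sqrtr1.
  have vl := lower r0 ns.
  have w0 : 0 <= cos_weight N k j :> R by exact: cos_weight_ge0.
  have w2 : cos_weight N k j <= 2 :> R by exact: cos_weight_le2.
  have h1 := ler_wpM2l w0 vl.
  have h2 := ler_wpM2r kE w2.
  by apply: le_trans h1; rewrite mulrN lerN2.
have hi : N%:R^-1 * \sum_(j < N) cos_weight N k j * \int[m]_y f j y <=
  \int[m]_y Re (psi y) -
    2^-1 * \int[m]_y (Re (psi y) * ((r * x y) ^+ k / k`!%:R)) +
  2^-1 ^+ n * (4 * \int[m]_y (normc (psi y) * expR (2 * r * x y))).
  have j1 := integrableZl measurableT 2^-1 ik.
  have j2 := integrableB measurableT i1 j1.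
  have j3 := integrableZl measurableT 4 ie.
  have j4 := integrableZl measurableT (2^-1 ^+ n) j3.
  rewrite -sE -RintegralZl// -[X in _ - X + _](RintegralZl _ measurableT ik).
  rewrite -[X in X + _](RintegralB measurableT i1 j1).
  rewrite -(RintegralZl _ measurableT ie) -(RintegralZl _ measurableT j3).
  rewrite -(RintegralD measurableT j2 j4).
  apply: le_Rintegral => //.
  - exact: (integrableZl measurableT _ si).
  - exact: (integrableD measurableT j2 j4).
  - by move=> y _; exact: cos_weight_pointwise.
have nE : 2^-1 ^+ n = 2^-1 ^+ l * 2^-1 ^+ k.+1 :> R by rewrite /n exprD.
have := le_trans lo hi; rewrite nE /D.
set I1 := \int[m]_y Re _; set Ik := \int[m]_y (Re _ * _).
set Ie := \int[m]_y (_ * expR _) => h.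
rewrite [X in _ <= _ + X]mulrA; move: h; set e := 2^-1 ^+ l * _.
rewrite !(mulrCA e); set t := e * Ie; lra.
Qed.

End borel_caratheodory.

(** * Nonnegativity forces the support into [0, A] *)

Section positivity.
Context {R : realType} d (Y : measurableType d).
Context (m : {sigma_finite_measure set Y -> \bar R}) (x : Y -> R).
Hypothesis hx : lebesgue_distributed m x.

Let mx : measurable_fun setT x. Proof. exact: hx.1. Qed.

Variable psi : Y -> R[i].
Hypothesis epsi : expintegrable m x psi.
Hypothesis psi_ge0 : forall y, 0 <= Re (psi y).
Variables (A K : R).
Hypotheses (A0 : 0 < A) (K0 : 0 <= K).
Hypothesis lower : forall (r : R) (s : R[i]), 0 <= r -> normc s <= r ->
  - (K * expR (A * r)) <= Re (laplace m x psi s).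

Definition ray_indicator (T y : R) : R := (T <= y)%R%:R.

Lemma ray_indicator_integrable T :
  m.-integrable setT (EFin \o (fun y => Re (psi y) * ray_indicator T (x y))).
Proof.
have [[mr _] _ _] := epsi.
have [i1 _] := expintegrable_cintegrable hx epsi.
apply: (le_integrable measurableT _ _ i1).
  apply/measurable_EFinP; apply: measurable_funM => //.
  rewrite (_ : (fun y => _) = (fun y => if T <= x y then cst 1 y else cst 0 y)).
    by apply: measurable_fun_if => //; exact: measurable_fun_ler.
  by apply/funext => y; rewrite /ray_indicator; case: ifP.
move=> y _ /=; rewrite lee_fin normrM ler_piMr// /ray_indicator.
by case: (T <= x y); rewrite ?normr1 ?normr0.
Qed.

(** Since [Re psi >= 0], restricting the [k]-th moment to [x >= T] decreases
    it. *)
Lemma tail_moment (T r : R) k : 0 < T -> 0 <= r ->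
  (T * r) ^+ k / k`!%:R * \int[m]_y (Re (psi y) * ray_indicator T (x y)) <=
  (2 * \int[m]_y Re (psi y) + 4 * K) * expR (A * r).
Proof.
move=> T0 r0; have [i1 _] := expintegrable_cintegrable hx epsi.
have ih := ray_indicator_integrable T.
have c0 : 0 <= \int[m]_y Re (psi y) by apply: Rintegral_ge0.
have e1 : 1 <= expR (A * r) by rewrite -expR0 ler_expR mulr_ge0// ltW.
have mom : \int[m]_y (Re (psi y) * ((r * x y) ^+ k / k`!%:R)) <=
    (2 * \int[m]_y Re (psi y) + 4 * K) * expR (A * r).
  have i2 : 2 * \int[m]_y Re (psi y) <= 2 * \int[m]_y Re (psi y) * expR (A * r).
    by rewrite ler_peMr// mulr_ge0.
  have i3 : 0 <= K * expR (A * r) by rewrite mulr_ge0// expR_ge0.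
  rewrite mulrDl -(mulrA 4).
  case: k => [|k].
    under eq_Rintegral do rewrite expr0 fact0 divr1 mulr1.
    lra.
  by have := moment_bound hx epsi K0 lower r0 (ltn0Sn k); lra.
apply: (le_trans _ mom); rewrite -RintegralZl//.
apply: le_Rintegral => //.
- exact: (integrableZl measurableT _ ih).
- exact: moment_integrable.
move=> y _; rewrite mulrCA; have [_ p0 _] := epsi.
have [xy|xy] := leP 0 (x y); last by rewrite p0//= !mul0r.
rewrite ler_wpM2l// /ray_indicator; case: (leP T (x y)) => Txy /=; last first.
  by rewrite mulr0 divr_ge0// exprn_ge0// mulr_ge0.
rewrite mulr1 ler_wpM2r ?invr_ge0// lerXn2r ?nnegrE ?mulr_ge0// ?(ltW T0)//.
by rewrite mulrC ler_wpM2l.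
Qed.

(** Let [c] be the integral. With [la < 1] such that [la T > A], summing the
    bounds for the moments against [la^k] gives
    [c exp(la T r) <= D exp(A r)] for all [r], which is absurd for large [r]
    unless [c = 0]. *)
Lemma tail_integral_eq0 (T : R) : A < T ->
  \int[m]_y (Re (psi y) * ray_indicator T (x y)) = 0.
Proof.
move=> AT; have T0 : 0 < T := lt_trans A0 AT.
set c := \int[m]_y _; pose K2 := 2 * \int[m]_y Re (psi y) + 4 * K.
have c0 : 0 <= c.
  by apply: Rintegral_ge0 => y _; rewrite mulr_ge0// /ray_indicator ler0n.
have I0 : 0 <= \int[m]_y Re (psi y) by apply: Rintegral_ge0.
have K20 : 0 <= K2 by rewrite addr_ge0// mulr_ge0.
(* any [la] with [A / T < la < 1] works; this is the midpoint *)
pose la := (A + T) / (2 * T).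
have la0 : 0 < la by rewrite divr_gt0 ?addr_gt0 ?mulr_gt0.
have la1 : la < 1 by rewrite ltr_pdivrMr ?mulr_gt0// mul1r; lra.
have laT : la * T = (A + T) / 2 by rewrite /la; field; exact: lt0r_neq0.
pose D := K2 / (1 - la).
have part r n : 0 <= r ->
    c * cos_taylor 0 0 n (la * T * r) <= D * expR (A * r).
  move=> r0.
  apply: (@le_trans _ _ (\sum_(k < n) la ^+ k * (K2 * expR (A * r)))).
    rewrite /cos_taylor mulr_sumr; apply: ler_sum => k _.
    rewrite mulr0 addr0 cos0 mulr1.
    have -> : c * ((la * T * r) ^+ k / k`!%:R) = la ^+ k * ((T * r) ^+ k / k`!%:R * c).
      by rewrite -mulrA exprMn; ring.
    by rewrite ler_wpM2l ?exprn_ge0 ?(ltW la0)//; exact: tail_moment.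
  rewrite -mulr_suml /D.
  have -> : K2 / (1 - la) * expR (A * r) = (1 - la)^-1 * (K2 * expR (A * r)) by ring.
  rewrite ler_wpM2r ?mulr_ge0 ?expR_ge0//.
  have l1 : 0 < 1 - la by rewrite subr_gt0.
  rewrite -[leRHS]mulr1 ler_pdivlMl//.
  have := subrX1 la n => e.
  have p : 0 <= la ^+ n by rewrite exprn_ge0 ?ltW.
  have -> : (1 - la) * \sum_(i < n) la ^+ i = 1 - la ^+ n.
    by rewrite -opprB mulNr -e opprB.
  by rewrite lerBlDr lerDl.
have full r : 0 <= r -> c * expR (la * T * r) <= D * expR (A * r).
  move=> r0; apply: (@le_geometric_eps _ _ _ (c * expR (2 * (la * T * r)))) => n.
  have z0 : 0 <= la * T * r by rewrite mulr_ge0// mulr_ge0 ?ltW.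
  have := expcos_taylor 0 0 n z0.
  rewrite /expcos cos0 sin0 mulr0 add0r cos0 !mulr1 lerBlDl => h.
  have h2 := ler_wpM2l c0 h; apply: (le_trans h2).
  by rewrite mulrDr mulrCA lerD2r part.
pose de := (T - A) / 2.
have de0 : 0 < de by rewrite divr_gt0// subr_gt0.
have lin r : 0 <= r -> c * (1 + de * r) <= D.
  move=> r0; have := full r r0; rewrite laT.
  have -> : (A + T) / 2 * r = A * r + de * r by rewrite /de; field.
  rewrite expRD mulrCA mulrC ler_pM2r ?expR_gt0//; apply: le_trans.
  by rewrite ler_wpM2l// expR_ge1Dx.
apply/eqP; rewrite eq_le c0 andbT leNgt; apply/negP => cp.
have D0 : 0 <= D by rewrite divr_ge0// subr_ge0 ltW.
have q0 : 0 <= D / (c * de) by apply: divr_ge0 => //; rewrite mulr_ge0// ltW.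
have := lin (D / (c * de)) q0.
have -> : c * (1 + de * (D / (c * de))) = c + D by field; rewrite !lt0r_neq0.
lra.
Qed.

Lemma Re_eq0_beyond : {ae m, forall y, A < x y -> Re (psi y) = 0}.
Proof.
have H n : {ae m, forall y, Re (psi y) * ray_indicator (A + n.+1%:R^-1) (x y) = 0}.
  have T0 : A < A + n.+1%:R^-1 by rewrite ltrDl invr_gt0.
  have i := ray_indicator_integrable (A + n.+1%:R^-1).
  have : ae_eq m setT (EFin \o (fun y => Re (psi y) *
      ray_indicator (A + n.+1%:R^-1) (x y))) (cst 0%E).
    apply/(ae_eq_integral_abs m measurableT); first exact: measurable_int i.
    transitivity (\int[m]_y (Re (psi y) * ray_indicator (A + n.+1%:R^-1) (x y))%:E)%E.
      apply: eq_integral => y _ /=.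
      by rewrite ger0_norm// mulr_ge0// /ray_indicator ler0n.
    rewrite -[LHS]fineK ?integrable_fin_num//; congr EFin.
    exact: (tail_integral_eq0 T0).
  by apply: filterS => y /(_ I) /= [].
apply: filterS (ae_foralln H) => y Hy Axy.
have d0 : 0 < x y - A by rewrite subr_gt0.
pose n := Num.bound (x y - A)^-1.
have nb : (x y - A)^-1 < n%:R by rewrite archi_boundP// invr_ge0 ltW.
have := Hy n; rewrite /ray_indicator.
suff -> : A + n.+1%:R^-1 <= x y by rewrite mulr1.
rewrite -lerBrDl -[leRHS]invrK lef_pV2 ?posrE ?invr_gt0//.
by rewrite (le_trans (ltW nb))// ler_nat.
Qed.

End positivity.

(** * The integral equation rewritten in terms of tails *)

Section renewal_equation.
Context {R : realType} d (Y : measurableType d).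
Context (m : {sigma_finite_measure set Y -> \bar R}) (x : Y -> R).
Hypothesis hx : lebesgue_distributed m x.

Let mx : measurable_fun setT x. Proof. exact: hx.1. Qed.

Definition segment_indicator (u v : R) : R := ((0 < v) && (v < u))%R%:R.
Local Notation O := segment_indicator.

Lemma measurable_segment (u : R) d' (Z : measurableType d') (f : Z -> R) :
  measurable_fun setT f -> measurable_fun setT (fun z => O u (f z)).
Proof.
move=> mf.
rewrite (_ : (fun y => _) = (fun y => if (0 < f y) && (f y < u) then cst 1 y else cst 0 y)).
  apply: measurable_fun_if => //; apply: measurable_and.
    exact: measurable_fun_ltr.
  exact: measurable_fun_ltr.
by apply/funext => y; rewrite /O; case: ifP.
Qed.

Lemma segment_integrable (u : R) : 0 <= u ->
  m.-integrable setT (EFin \o (fun y => O u (x y))) /\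
  \int[m]_y O u (x y) = u.
Proof.
move=> u0; have mO : measurable_fun setT (O u) by exact: measurable_segment.
have OE : O u = \1_(`]0, u[%classic : set R).
  by apply/funext => v; rewrite indicE /O mem_setE in_itv.
have iO : (@lebesgue_measure R).-integrable setT (EFin \o O u).
  by rewrite OE; exact: integrable_indic_itv.
have im := (integrable_transport hx mO).2 iO.
split=> //; rewrite [LHS](Rintegral_transport hx mO im) OE /Rintegral.
rewrite integral_indic// setIT.
have := lebesgue_measure_bnd false true u0; rewrite subr0 => mE.
exact: (congr1 fine mE).
Qed.

Variables (phi : Y -> R[i]) (tau : R -> R[i]) (c : R[i]) (M : R).
Hypothesis ephi : expintegrable m x phi.
Hypothesis phi_nonpos : forall y, x y <= 0 -> phi y = 0.
Hypothesis mtau : cmfun tau.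
Hypothesis etau : expintegrable m x (tau \o x).
Hypothesis tauM : forall u, normc (tau u) <= M.
Hypothesis tau_nonpos : forall u, u <= 0 -> tau u = 0.
(* [tau + c] solves the integral equation for [chi = 1 - phi] *)
Hypothesis equation : forall u : R, 0 < u -> u%:C * (tau u + c) =
  cint m (fun y => (O u (x y))%:C * ((1 - phi y) * (tau (u - x y) + c))).

Let itau : cintegrable m (tau \o x). Proof. exact: (expintegrable_cintegrable hx). Qed.
Let iphi : cintegrable m phi. Proof. exact: (expintegrable_cintegrable hx). Qed.

(** For [u > 0] the half-line splits into [(0, u)] and [[u, oo)]. *)
Lemma segment_split (u : R) (f : Y -> R[i]) : 0 < u -> expintegrable m x f ->
  (forall y, x y <= 0 -> f y = 0) ->
  cintegrable m (fun y => (O u (x y))%:C * f y) /\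
  cint m (fun y => (O u (x y))%:C * f y) = cint m f - tail m x f u.
Proof.
move=> u0 ef f0; have i := expintegrable_cintegrable hx ef.
have it := tail_integrable hx u ef.
have E y : (O u (x y))%:C * f y = f y + - ((window (x y) u)%:C * f y).
  have [xy|xy] := leP (x y) 0; first by rewrite f0// !mulr0 subrr.
  rewrite /O /window xy u0 /=; case: (ltP (x y) u) => _ /=.
    by rewrite mul0r subr0 mul1r.
  by rewrite mul0r mul1r subrr.
have iN := cintegrableN it.
rewrite (eq_fun E); split; first exact: (cintegrableD i iN).
by rewrite (cintD i iN) (cintN it).
Qed.

(** Expand the product in the equation, using [tau(u - x) = 0] for [x >= u],
    and complete the integrals over [(0, u)] to the half-line at the cost of
    tails. *)
Lemma renewal_const (u : R) : 0 < u -> u%:C * tau u =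
  (cint m (tau \o x) - c * cint m phi) +
  c * tail m x phi u - tail m x (tau \o x) u - conv m x phi tau u.
Proof.
move=> u0.
have [i1 e1] := segment_split u0 etau (fun y xy => tau_nonpos xy).
have [i2 e2] := segment_split u0 ephi phi_nonpos.
have ic := conv_integrable hx u ephi mtau tauM.
have [iO eO] := segment_integrable (ltW u0).
have iOc : cintegrable m (fun y => (O u (x y))%:C) by split => //; exact: integrable0.
have eOc : cint m (fun y => (O u (x y))%:C) = u%:C.
  by apply: complex_ext; rewrite /= ?eO// Rintegral_cst// mul0r.
pose ft v : R[i] := (O u v)%:C * tau v.
have mft : cmfun ft by apply: cmfunM => //; apply: cmfun_real; exact: measurable_segment.
have [i3 e3] := cint_transport hx (distributed_reflect hx u) mft i1.
have OE v : O u (u - v) = O u v.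
  by rewrite /O subr_gt0 ltrBlDl ltrDr andbC.
have E y : (O u (x y))%:C * ((1 - phi y) * (tau (u - x y) + c)) =
    ft (u - x y) + c * (O u (x y))%:C + - (phi y * tau (u - x y)) +
    - (c * ((O u (x y))%:C * phi y)).
  rewrite /ft OE.
  have [xy|xy] := leP (x y) 0.
    rewrite phi_nonpos// /O ltNge xy /= !(mul0r, mulr0, oppr0, addr0).
    reflexivity.
  rewrite /O xy /=; have [xu|xu] := ltP (x y) u => /=.
    rewrite !mul1r; ring.
  rewrite (@tau_nonpos (u - x y)) ?subr_le0// !(mul0r, mulr0, oppr0, addr0); reflexivity.
have eq := equation u0; rewrite (eq_cint _ E) in eq.
have j1 := cintegrableZ c iOc.
have j2 := cintegrableD i3 j1.
have j3 := cintegrableN ic.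
have j4 := cintegrableD j2 j3.
have j5 := cintegrableZ c i2.
have j6 := cintegrableN j5.
move: eq; rewrite (cintD j4 j6) (cintD j2 j3) (cintD i3 j1) (cintN ic) (cintN j5).
rewrite (cintZ c i2) (cintZ c iOc) e3 eOc e2.
rewrite [cint m (ft \o x)]e1 mulrDr => eq.
apply: (addIr (u%:C * c)); rewrite eq /conv; ring.
Qed.

(** All other terms of the preceding identity are integrable in [u], whereas a
    nonzero constant is not integrable over the half-line. *)
Lemma renewal_const_eq0 : cint m (tau \o x) = c * cint m phi.
Proof.
set k := cint m (tau \o x) - c * cint m phi.
suff k0 : k = 0 by apply/eqP; rewrite -subr_eq0; apply/eqP.
have kernel0E (f : Y -> R[i]) : (fun y => f y * cexp (- ((x y)%:C * 0))) = f.
  by apply/funext => y; rewrite kernel0.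
have [i1 _] := laplace_tail hx 0 ephi; rewrite kernel0E in i1.
have [i2 _] := laplace_tail hx 0 etau; rewrite kernel0E in i2.
have [i3 _] := laplace_conv hx 0 ephi mtau etau tauM; rewrite kernel0E in i3.
have i4 := expintegrable_cintegrable hx (expintegrable_mulx hx etau).
have j1 := cintegrableN (cintegrableZ c i1).
have j2 := cintegrableD (cintegrableD (cintegrableD i4 j1) i2) i3.
have jn := cintegrable_normc j2.
set G := fun y => mulx x (tau \o x) y + _ + _ + _ in jn.
have GE y : 0 < x y -> G y = k.
  move=> xy; have := renewal_const xy; rewrite -/k /G /mulx /= => ->; ring.
have bound u : 0 <= u -> normc k * u <= \int[m]_y normc (G y).
  move=> u0; have [iO eO] := segment_integrable u0.
  rewrite -[X in _ * X <= _]eO -RintegralZl//; apply: le_Rintegral => //.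
    exact: (integrableZl measurableT _ iO).
  move=> y _; rewrite /O; case: (ltP 0 (x y)) => xy /=.
    by rewrite GE//; case: (x y < u); rewrite ?mulr1// mulr0 normc_ge0.
  by rewrite mulr0 normc_ge0.
apply: Normc.eq0_normc; apply/eqP; rewrite eq_le normc_ge0 andbT leNgt.
apply/negP => kp; set I := \int[m]_y _ in bound.
have I0 : 0 <= I by apply: Rintegral_ge0 => y _; exact: normc_ge0.
have := bound ((I + 1) / normc k); rewrite divr_ge0 ?addr_ge0 ?(ltW kp)// => /(_ isT).
by rewrite mulrC divfK ?lt0r_neq0//; lra.
Qed.

Lemma renewal_identity (u : R) : u%:C * tau u =
  c * tail m x phi u - tail m x (tau \o x) u - conv m x phi tau u.
Proof.
have [u0|u0] := ltP 0 u.
  by rewrite (renewal_const u0) renewal_const_eq0 subrr add0r.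
have t0 (f : Y -> R[i]) : tail m x f u = 0.
  rewrite /tail (@eq_cint _ _ _ _ _ (fun=> 0)) ?cint0// => y.
  by rewrite /window ltNge u0 mul0r.
have -> : conv m x phi tau u = 0.
  rewrite /conv (@eq_cint _ _ _ _ _ (fun=> 0)) ?cint0// => y.
  have [xy|xy] := leP (x y) 0; first by rewrite phi_nonpos// mul0r.
  by rewrite tau_nonpos ?mulr0// subr_le0 (le_trans u0)// ltW.
rewrite tau_nonpos// !t0 !mulr0 !subr0; reflexivity.
Qed.

End renewal_equation.

(** * Continuity and measurability of real and imaginary parts *)

Section continuous_parts.
Context {R : realType}.

Lemma ball_normc (z w : R[i]^o) (e : R) : ball z e%:C w -> normc (z - w) < e.
Proof. by rewrite -ball_normE /= normc_def ltcR; case: (z - w). Qed.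

Lemma continuous_Re : continuous (Re : R[i]^o -> R^o).
Proof.
move=> z; apply/(@cvgrPdist_lt R R^o _ (nbhs z) (nbhs_filter z)) => e e0.
have nb : nbhs z (ball z (e%:C : R[i])) by apply: nbhsx_ballx; rewrite ltcR.
apply: (@filterS _ (nbhs z) (nbhs_filter z) _ _ _ nb) => w /ball_normc.
apply: le_lt_trans.
by rewrite -ReN -ReD Re_le_normc.
Qed.

Lemma continuous_Im : continuous (Im : R[i]^o -> R^o).
Proof.
move=> z; apply/(@cvgrPdist_lt R R^o _ (nbhs z) (nbhs_filter z)) => e e0.
have nb : nbhs z (ball z (e%:C : R[i])) by apply: nbhsx_ballx; rewrite ltcR.
apply: (@filterS _ (nbhs z) (nbhs_filter z) _ _ _ nb) => w /ball_normc.
apply: le_lt_trans.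
by rewrite -ImN -ImD Im_le_normc.
Qed.

Variable sigma : R -> R[i].
Hypothesis sigma_cont : {within `[0, +oo[, continuous (sigma : R -> R[i]^o)}.

Lemma within_Re : {within `[0, +oo[, continuous (Re \o sigma : R -> R)}.
Proof.
apply: (@within_continuous_comp R[i]^o R R `[0, +oo[ sigma Re).
  by move=> z _; exact: continuous_Re.
exact: sigma_cont.
Qed.

Lemma within_Im : {within `[0, +oo[, continuous (Im \o sigma : R -> R)}.
Proof.
apply: (@within_continuous_comp R[i]^o R R `[0, +oo[ sigma Im).
  by move=> z _; exact: continuous_Im.
exact: sigma_cont.
Qed.

Lemma within_bounded (f : R -> R) (b : R) : 0 <= b ->
  {within `[0, +oo[, continuous f} ->
  exists M, forall u, 0 <= u <= b -> `|f u| <= M.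
Proof.
move=> b0 cf.
have cf' : {within `[0, b], continuous (Num.norm \o f : R -> R)}.
  move=> u; apply: (@continuous_comp (subspace `[0, b]) R R f Num.norm).
    apply: continuous_subspaceW cf u.
    by apply: subset_itvl; rewrite bnd_simp.
  exact: norm_continuous.
have [v _ Hv] := EVT_max b0 cf'.
by exists `|f v| => u ub; apply: Hv; rewrite in_itv.
Qed.

Lemma sigma_bounded (b : R) : 0 <= b ->
  exists M, forall u, 0 <= u <= b -> normc (sigma u) <= M.
Proof.
move=> b0; have [M1 H1] := within_bounded b0 within_Re.
have [M2 H2] := within_bounded b0 within_Im.
exists (M1 + M2) => u ub; apply: (le_trans (normc_le_ReIm _)).
by rewrite lerD ?H1 ?H2.
Qed.

Lemma cmfun_positive_part (c : R[i]) :
  cmfun (fun u : R => if 0 < u then sigma u - c else 0).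
Proof.
have P (f : R -> R) (k : R) : {within `[0, +oo[, continuous f} ->
    measurable_fun setT (fun u : R => if 0 < u then f u - k else 0).
  move=> cf; apply: measurable_fun_if => //; first exact: measurable_fun_ltr.
  rewrite setTI; apply: measurable_funB => //.
  have m1 : measurable_fun (`[0, +oo[%classic : set R) f.
    exact: subspace_continuous_measurable_fun.
  apply: measurable_funS m1 => // u /=.
  by rewrite in_itv/= andbT => /ltW.
split.
  rewrite (_ : _ \o _ = fun u : R => if 0 < u then (Re \o sigma) u - Re c else 0).
    by apply: P; exact: within_Re.
  by apply/funext => u /=; case: ifP => _ //; rewrite ReD ReN.
rewrite (_ : _ \o _ = fun u : R => if 0 < u then (Im \o sigma) u - Im c else 0).
  by apply: P; exact: within_Im.
by apply/funext => u /=; case: ifP => _ //; rewrite ImD ImN.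
Qed.

End continuous_parts.

(** * The theorem *)

Section main.
Context {R : realType} d (Y : measurableType d).
Context (m : {sigma_finite_measure set Y -> \bar R}) (x : Y -> R).
Hypothesis hx : lebesgue_distributed m x.

Let mx : measurable_fun setT x. Proof. exact: hx.1. Qed.

Variables (chi : Y -> R[i]) (sigma : R -> R[i]).
Local Notation D := [set y | 0 < x y].
Hypothesis chi_mRe : measurable_fun D (Re \o chi).
Hypothesis chi_mIm : measurable_fun D (Im \o chi).
Hypothesis chi_1 : forall y, 0 < x y <= 1 -> chi y = 1.
Hypothesis chi_le1 : forall y, 1 <= x y -> normc (chi y) <= 1.
Hypothesis sigma_cont : {within `[0, +oo[, continuous (sigma : R -> R[i]^o)}.
Hypothesis sigma_1 : forall u : R, 0 <= u <= 1 -> sigma u = 1.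
Hypothesis sigma_eq : forall u : R, 1 < u -> u%:C * sigma u =
  (\int[m]_(y in [set y | 0 < x y < u]) Re (chi y * sigma (u - x y))) +i*
  (\int[m]_(y in [set y | 0 < x y < u]) Im (chi y * sigma (u - x y))).
Variables (c : R[i]) (A : R).
Hypotheses (c0 : c != 0) (A0 : 0 < A).
Hypothesis sigma_decay : \forall u \near +oo,
  normc (sigma u - c) <= expR (- ((u / A) * ln u)).
Hypothesis exp_moments : forall C : R, 0 <= C ->
  (\int[m]_(y in D) (normc (1 - chi y) / x y * expR (C * x y))%:E != +oo)%E.

Let phi y : R[i] := if 0 < x y then 1 - chi y else 0.
(* [psi] is written with a real power because its measurability is then
   immediate; on the support of [phi] the factor is [1 / x]. *)
Let psi y : R[i] := (x y `^ (-1))%:C * phi y.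
Let tau u : R[i] := if 0 < u then sigma u - c else 0.

Let mD : measurable D.
Proof.
have -> : D = x @^-1` `]0, +oo[%classic.
  by apply/seteqP; split=> y /=; rewrite in_itv/= andbT.
by rewrite -[X in measurable X]setTI; exact: mx.
Qed.

Let phiE : phi = mulx x psi.
Proof.
apply/funext => y; rewrite /mulx /psi mulrA -rmorphM/= /phi.
case: ifPn => xy; last by rewrite mulr0.
by rewrite powR_inv1 ?(ltW xy)// divff ?mul1r// lt0r_neq0.
Qed.

Let mphi : cmfun phi.
Proof.
have P (f : Y -> R) (k : R) : measurable_fun D f ->
    measurable_fun setT (fun y => if 0 < x y then k - f y else 0).
  move=> mf; apply: measurable_fun_if => //; first exact: measurable_fun_ltr.
  by rewrite setTI; apply: measurable_funB.
split.
  rewrite (_ : _ \o _ = fun y => if 0 < x y then 1 - (Re \o chi) y else 0).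
    exact: P.
  by apply/funext => y; rewrite /phi /=; case: ifP => // _; rewrite ReD ReN.
rewrite (_ : _ \o _ = fun y => if 0 < x y then 0 - (Im \o chi) y else 0).
  exact: P.
by apply/funext => y; rewrite /phi /=; case: ifP => // _; rewrite ImD ImN.
Qed.

Let mpsi : cmfun psi.
Proof.
apply: cmfunM => //; apply: cmfun_real.
exact: (measurableT_comp (measurable_powR (-1))).
Qed.

Let psi_nonpos y : x y <= 0 -> psi y = 0.
Proof. by move=> xy; rewrite /psi /phi ltNge xy mulr0. Qed.

Let normc_psi y : 0 < x y -> normc (psi y) = normc (1 - chi y) / x y.
Proof.
move=> xy; rewrite /psi /phi xy Normc.normcM normc_real powR_inv1 ?(ltW xy)//.
by rewrite ger0_norm ?invr_ge0 ?(ltW xy)// mulrC.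
Qed.

Let epsi : expintegrable m x psi.
Proof.
split=> // [y xy|C]; first by rewrite psi_nonpos// ltW.
have me (k : R) : measurable_fun setT (fun y => normc (psi y) * expR (k * x y)).
  apply: measurable_funM; first exact: cmfun_normc.
  apply: (measurableT_comp (continuous_measurable_fun (@continuous_expR R))).
  exact: measurable_funM.
have i : m.-integrable setT (EFin \o (fun y => normc (psi y) * expR (`|C| * x y))).
  apply/integrableP; split; first exact/measurable_EFinP.
  rewrite ltey (_ : integral _ _ _ = \int[m]_(y in D)
    (normc (1 - chi y) / x y * expR (`|C| * x y))%:E)%E; first exact: exp_moments.
  rewrite [RHS]integral_mkcond; apply: eq_integral => y _.
  rewrite patchE /=; case: ifPn => [|].
    rewrite inE /= => xy; rewrite normc_psi// ger0_norm// mulr_ge0 ?expR_ge0//.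
    by rewrite divr_ge0 ?normc_ge0// ltW.
  rewrite notin_setE /= => /negP; rewrite -leNgt => xy.
  by rewrite psi_nonpos// Normc.normc0 mul0r normr0.
apply: (le_integrable measurableT _ _ i); first exact/measurable_EFinP.
move=> y _ /=; rewrite lee_fin ger0_norm ?mulr_ge0 ?normc_ge0 ?expR_ge0//.
apply: (le_trans _ (ler_norm _)); have [xy|xy] := leP (x y) 0.
  by rewrite psi_nonpos// Normc.normc0 !mul0r.
by rewrite ler_wpM2l ?normc_ge0// ler_expR ler_wpM2r ?(ltW xy)// ler_norm.
Qed.

Let psi_ge0 y : 0 <= Re (psi y).
Proof.
have [xy|xy] := leP (x y) 0; first by rewrite psi_nonpos.
rewrite /psi /phi xy ReM /= mul0r subr0 mulr_ge0 ?powR_ge0// ReD ReN /= subr_ge0.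
have [x1|x1] := leP (x y) 1; first by rewrite chi_1 ?xy.
by rewrite (le_trans (ler_norm _))// (le_trans (Re_le_normc _))// chi_le1// ltW.
Qed.

Let ephi : expintegrable m x phi.
Proof. by rewrite phiE; exact: expintegrable_mulx. Qed.

Let phi_nonpos y : x y <= 0 -> phi y = 0.
Proof. by move=> xy; rewrite /phi ltNge xy. Qed.

Let mtau : cmfun tau.
Proof. exact: cmfun_positive_part. Qed.

Let tau_nonpos u : u <= 0 -> tau u = 0.
Proof. by move=> u0; rewrite /tau ltNge u0. Qed.

Let decay : exists2 u0, 1 <= u0 & forall u, u0 <= u ->
  normc (tau u) <= expR (- (u / A * ln u)).
Proof.
have [M [_ HM]] := sigma_decay.
exists (Num.max 1 (M + 1)); first by rewrite le_max lexx.
move=> u; rewrite ge_max => /andP[u1 uM].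
rewrite /tau (lt_le_trans ltr01 u1); apply: HM.
by rewrite (lt_le_trans _ uM)// ltrDl.
Qed.

Let bounded : exists2 M, 0 <= M & forall u, normc (tau u) <= M.
Proof.
have [u0 u01 Hu0] := decay.
have u00 : 0 <= u0 := le_trans ler01 u01.
have [M HM] := sigma_bounded sigma_cont u00.
have M0 : 0 <= M by rewrite (le_trans (normc_ge0 _) (HM 0 _))// lexx.
exists (M + normc c + 1); first by rewrite !addr_ge0 ?normc_ge0.
move=> u; have [uu0|uu0] := leP u0 u.
  rewrite (le_trans (Hu0 u uu0))// -[leLHS]add0r lerD ?addr_ge0 ?normc_ge0//.
  have u1 := le_trans u01 uu0.
  rewrite -expR0 ler_expR oppr_le0 mulr_ge0 ?divr_ge0 ?ln_ge0 ?(ltW A0)//.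
  exact: le_trans ler01 u1.
rewrite /tau; case: ifPn => u_gt0; last by rewrite Normc.normc0 !addr_ge0 ?normc_ge0.
rewrite (le_trans (cnormD _ _))// cnormN -[leLHS]addr0 !lerD//.
by rewrite HM// (ltW u_gt0) ltW.
Qed.

Let equation (u : R) : 0 < u -> u%:C * (tau u + c) =
  cint m (fun y => (segment_indicator u (x y))%:C *
    ((1 - phi y) * (tau (u - x y) + c))).
Proof.
move=> u0; rewrite {1}/tau u0 subrK.
have [iO eO] := segment_integrable hx (ltW u0).
have GE y : (segment_indicator u (x y))%:C * ((1 - phi y) * (tau (u - x y) + c)) =
   if 0 < x y < u then chi y * sigma (u - x y) else 0.
  rewrite /segment_indicator; case: ifPn => [/andP[xy xu]|_]; last by rewrite mul0r.
  by rewrite mul1r /phi xy /tau subr_gt0 xu subrK opprB addrCA subrr addr0.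
rewrite (eq_cint _ GE).
have [u1|u1] := leP u 1.
  rewrite sigma_1 ?(ltW u0)// mulr1.
  rewrite (@eq_cint _ _ _ _ _ (fun y => (segment_indicator u (x y))%:C)).
    by apply: complex_ext; rewrite /= ?eO// Rintegral_cst// mul0r.
  move=> y; rewrite /segment_indicator; case: ifPn => // /andP[xy xu].
  rewrite chi_1 ?xy ?(le_trans (ltW xu))// mul1r sigma_1//.
  by rewrite subr_ge0 (ltW xu) lerBlDr (le_trans u1)// lerDl ltW.
have patch_if (P : R[i] -> R) : P 0 = 0 ->
    \int[m]_(y in [set y | 0 < x y < u]) P (chi y * sigma (u - x y)) =
    \int[m]_y P (if 0 < x y < u then chi y * sigma (u - x y) else 0).
  move=> P0; rewrite Rintegral_mkcond; apply: eq_Rintegral => y _.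
  rewrite patchE; case: ifPn => [/set_mem /= ->//|/negP ny].
  by case: ifPn => // yu; exfalso; apply: ny; apply: mem_set.
by rewrite sigma_eq// /cint !patch_if.
Qed.

(** The theorem on a general measure space with a Lebesgue-distributed
    coordinate, in the case where all exponential moments are finite. *)
Lemma chi_eq1 : {ae m, forall y, A <= x y -> chi y = 1}.
Proof.
have [u0 u01 Hu0] := decay; have [M M0 HM] := bounded.
have u0_gt0 : 0 < u0 := lt_le_trans ltr01 u01.
have tau_neg u : u < 0 -> tau u = 0 by move=> /ltW; exact: tau_nonpos.
have etau := expintegrable_decay A0 M0 u0_gt0 mtau tau_neg HM Hu0 hx.
have ren := renewal_identity hx ephi phi_nonpos mtau etau HM tau_nonpos equation.
have ren0 := renewal_const_eq0 hx ephi phi_nonpos mtau etau HM tau_nonpos equation.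
rewrite -!(laplace0 m x) in ren0.
rewrite phiE in ren ren0.
have [K K0 lower] := laplace_lower_bound hx A0 M0 u0_gt0 c0 epsi mtau tau_neg HM Hu0 ren ren0.
have aeRe := Re_eq0_beyond hx epsi psi_ge0 A0 K0 lower.
have aeA : {ae m, forall y, x y <> A}.
  exists (x @^-1` [set A]); split.
  - by rewrite -[X in measurable X]setTI; exact: mx.
  - by have := hx.2 [set A] (measurable_set1 A); rewrite lebesgue_measure_set1.
  - by move=> y /= /contrapT.
apply: filterS2 aeRe aeA => y Hy yA Ay.
have Axy : A < x y by rewrite lt_neqAle Ay andbT eq_sym; apply/eqP.
have xy : 0 < x y := lt_trans A0 Axy.
have := Hy Axy; rewrite /psi /phi xy ReM /= mul0r subr0 ReD ReN /=.
(* [Re chi = 1] together with [|chi| <= 1] forces [Im chi = 0] *)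
move=> /eqP; rewrite mulf_eq0 => /orP[|]; first by rewrite gt_eqF// powR_gt0.
rewrite subr_eq0 => /eqP Re1.
have [x1|x1] := leP (x y) 1; first by rewrite chi_1 ?xy.
have n1 := chi_le1 (ltW x1).
have : normc (chi y) ^+ 2 <= 1 by rewrite exprn_ile1 ?normc_ge0.
rewrite sqr_normcE -Re1 expr1n gerDl => I0.
apply: complex_ext => //=; apply/eqP; rewrite -sqrf_eq0.
by rewrite eq_le I0 sqr_ge0.
Qed.

End main.

Theorem theorem7p2 (R : realType) (chi sigma : R -> R[i])
    (chi_meas : cmeasurable_fun `]0, +oo[ chi)
    (chi_1 : forall t : R, 0 < t <= 1 -> chi t = 1)
    (chi_le1 : forall t : R, 1 <= t -> Normc.normc (chi t) <= 1)
    (sigma_sol : integral_equation_solution chi sigma)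
    (sigma_oo : R[i]) (sigma_oo_neq0 : sigma_oo != 0)
    (A : R) (A_gt0 : 0 < A)
    (sigma_cvg : \forall u \near +oo,
       Normc.normc (sigma u - sigma_oo) <= expR (- ((u / A) * ln u))) :
  {ae @completed_lebesgue_measure R, forall t : R, A <= t -> chi t = 1} \/
  exists2 C : R, 0 <= C &
    (\int[@completed_lebesgue_measure R]_(t in `]0%R, +oo[%classic)
        (Normc.normc (1 - chi t) / t * expR (C * t))%:E = +oo)%E.
Proof.
have [[C [C0 HC]]|fin] := pselect (exists C : R, 0 <= C /\
    (\int[@completed_lebesgue_measure R]_(t in `]0%R, +oo[%classic)
        (Normc.normc (1 - chi t) / t * expR (C * t))%:E = +oo)%E).
  by right; exists C.
left.
have Dy : `]0, +oo[%classic = [set t : R | 0 < t].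
  by apply/seteqP; split=> t /=; rewrite in_itv/= andbT.
have Du (u : R) : `]0, u[%classic = [set t : R | 0 < t < u].
  by apply/seteqP; split=> t /=; rewrite in_itv.
have hx : lebesgue_distributed (@completed_lebesgue_measure R)
    (id : lebesgueType R -> R).
  by split=> [_ B mB|B mB //]; rewrite setTI; exact: sub_caratheodory.
have [s_cont s_1 s_eq] := sigma_sol.
case: chi_meas => mRe mIm.
rewrite Dy in mRe mIm.
have s_eq' (u : R) : 1 < u -> u%:C * sigma u =
  (\int[@completed_lebesgue_measure R]_(y in [set y : lebesgueType R | 0 < (y : R) < u])
     Re (chi y * sigma (u - y))) +i*
  (\int[@completed_lebesgue_measure R]_(y in [set y : lebesgueType R | 0 < (y : R) < u])
     Im (chi y * sigma (u - y))).
  by move=> u1; rewrite s_eq// /cintegral Du.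
apply: (chi_eq1 hx mRe mIm chi_1 chi_le1 s_cont s_1 s_eq' sigma_oo_neq0 A_gt0 sigma_cvg).
move=> C C0; apply/eqP => HC; apply: fin; exists C; split=> //.
by rewrite Dy.
Qed.
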